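(* Let $D$ be an integral domain. If $D$ is polynomially composite, and in particular if $D$ is a Krull domain or a TV PVMD, then $\operatorname{Int}(D)$ has a unique $D$-$D$-biring structure such that the inclusion $D[X]\to\operatorname{Int}(D)$ is a homomorphism of $D$-$D$-birings.
   Context: All rings and algebras are commutative with identity. For an integral domain $D$ with quotient field $K$ and a set $\mathbf X$, $\operatorname{Int}(D^{\mathbf X})=\{f\in K[\mathbf X] : f(D^{\mathbf X})\subseteq D\}$, and $\operatorname{Int}(D)=\{f\in K[X]: f(D)\subseteq D\}$. There is a canonical $D$-algebra homomorphism $\theta_{\mathbf X}:\bigotimes_{X\in\mathbf X}\operatorname{Int}(D)\to\operatorname{Int}(D^{\mathbf X})$ (tensor product over $D$, possibly infinite, i.e. the coproduct of $D$-algebras) sending $f$ in the factor indexed by $X$ to $f(X)$. The domain $D$ is polynomially composite if $\theta_{\mathbf X}$ is an isomorphism for every set $\mathbf X$. TV PVMD: for a nonzero fractional ideal $I$ of $D$, let $I^{-1}=\{x\in K: xI\subseteq D\}$, $I_v=(I^{-1})^{-1}$, and $I_t=\bigcup J_v$ over nonzero finitely generated $J\subseteq I$. $D$ is a PVMD if $(II^{-1})_t=D$ for every nonzero finitely generated ideal $I$; $D$ is a TV domain if $I_t=I_v$ for every nonzero ideal $I$; a TV PVMD is a PVMD that is a TV domain. Birings. Let $A,B$ be rings. An $A$-$B$-biring is an $A$-algebra $S$ together with the structure on $S$ of a $B$-algebra object in the opposite category of the category of $A$-algebras. Explicitly, $S$ is equipped with $A$-algebra homomorphisms $\Delta^+,\Delta^\times: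 S\to S\otimes_A S$ (co-addition and co-multiplication) and a co-$B$-linear structure $\beta: B\to \operatorname{Hom}_A(S,A)$ (the set of $A$-algebra homomorphisms), satisfying the duals of the laws defining $B$-algebras. Equivalently, it is an $A$-algebra $S$ with a lift of the functor $\operatorname{Hom}_A(S,-)$ from $A$-algebras to sets to a functor from $A$-algebras to $B$-algebras. A homomorphism of $A$-$B$-birings is an $A$-algebra homomorphism compatible with $\Delta^+$, $\Delta^\times$ and $\beta$. The polynomial ring $A[X]$ is an $A$-$A$-biring with $\Delta^+(X)=X\otimes1+1\otimes X$, $\Delta^\times(X)=X\otimes X$, $\beta(a)(f)=f(a)$. *)

(* Defs.v *)
From HB Require Import structures.
From mathcomp Require Import all_boot all_algebra finmap monalg.
From mathcomp Require Import boolp classical_sets functions cardinality.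

Set Implicit Arguments.
Unset Strict Implicit.
Unset Printing Implicit Defensive.

Import GRing.Theory.

Local Open Scope ring_scope.
Local Open Scope quotient_scope.

(** * Commutative algebras

    An algebra over a commutative ring [A] is a commutative ring with a ring
    homomorphism from [A]. The library's [comAlgType] excludes the zero ring,
    hence is not closed under tensor products. *)

HB.mixin Record hasAlgMap (A : comPzRingType) S of GRing.ComPzRing S := {
  algmap : {rmorphism A -> S}
}.

#[short(type="calgType")]
HB.structure Definition CAlg (A : comPzRingType) :=
  {S of GRing.ComPzRing S & hasAlgMap A S}.

Arguments algmap {A} s : rename.

HB.instance Definition _ (A : comPzRingType) :=
  hasAlgMap.Build A A^o (idfun : {rmorphism A -> A}).

HB.instance Definition _ (A : comNzRingType) :=
  hasAlgMap.Build A {poly A} (polyC : {rmorphism A -> {poly A}}).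

Section AlgHom.
Context (A : comPzRingType).

Definition is_alghom (S T : calgType A) (f : S -> T) : Prop :=
  [/\ {morph f : x y / x + y}, {morph f : x y / x * y}
    & forall a, f (algmap S a) = algmap T a].

Record alghom (S T : calgType A) := AlgHom {
  ah_fun :> S -> T;
  ahP : is_alghom ah_fun }.

Section Theory.
Context (S T : calgType A) (f : alghom S T).

Lemma ahD : {morph f : x y / x + y}. Proof. by case: (ahP f). Qed.
Lemma ahM : {morph f : x y / x * y}. Proof. by case: (ahP f). Qed.
Lemma ah_alg a : f (algmap S a) = algmap T a. Proof. by case: (ahP f). Qed.
Lemma ah1 : f 1 = 1.
Proof. by rewrite -(rmorph1 (algmap S)) ah_alg rmorph1. Qed.
Lemma ah0 : f 0 = 0.
Proof. by rewrite -(rmorph0 (algmap S)) ah_alg rmorph0. Qed.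

Lemma ah_is_nmod : nmod_morphism f.
Proof. by split; [exact: ah0 | exact: ahD]. Qed.
Lemma ah_is_monoid : monoid_morphism f.
Proof. by split; [exact: ah1 | exact: ahM]. Qed.
HB.instance Definition _ := GRing.isNmodMorphism.Build S T f ah_is_nmod.
HB.instance Definition _ := GRing.isMonoidMorphism.Build S T f ah_is_monoid.

End Theory.

Lemma ah_eq (S T : calgType A) (f g : alghom S T) : f =1 g -> f = g.
Proof.
case: f g => [f fP] [g gP] /= /funext fg.
by subst g; congr AlgHom; exact: Prop_irrelevance.
Qed.

Lemma ah_id_subproof (S : calgType A) : is_alghom (@id S).
Proof. by []. Qed.
Definition ah_id S := AlgHom (ah_id_subproof S).

Lemma ah_comp_subproof (S T U : calgType A) (g : alghom T U) (f : alghom S T) :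
  is_alghom (g \o f).
Proof. by split=> [x y|x y|a] /=; rewrite ?ahD ?ahM ?ah_alg. Qed.
Definition ah_comp S T U (g : alghom T U) (f : alghom S T) :=
  AlgHom (ah_comp_subproof g f).

Lemma ah_unit_subproof (R : calgType A) : is_alghom (algmap R : A^o -> R).
Proof. by split=> [x y|x y|a]; rewrite ?rmorphD ?rmorphM. Qed.
Definition ah_unit (R : calgType A) : alghom A^o R :=
  AlgHom (ah_unit_subproof R).

End AlgHom.

Arguments ah_id {A} S.
Arguments ah_unit {A} R.

(** * Tensor products

    The tensor product over [A] of a possibly infinite family of [A]-algebras,
    i.e. their coproduct, presented by generators and relations: it is
    generated as an [A]-algebra by elements [tinj i s], subject to the
    relations saying that each [tinj i] is an [A]-algebra homomorphism. *)

Section Tensor.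
Context (A : comPzRingType) (I : Type) (S : I -> calgType A).

Inductive tterm : Type :=
| TCst (a : A)
| TGen (i : I) (s : S i)
| TAdd (t u : tterm)
| TMul (t u : tterm).

Inductive teq : tterm -> tterm -> Prop :=
| teq_refl t : teq t t
| teq_sym t u : teq t u -> teq u t
| teq_trans t u v : teq t u -> teq u v -> teq t v
| teq_add t t' u u' : teq t t' -> teq u u' -> teq (TAdd t u) (TAdd t' u')
| teq_mul t t' u u' : teq t t' -> teq u u' -> teq (TMul t u) (TMul t' u')
| teq_addA t u v : teq (TAdd t (TAdd u v)) (TAdd (TAdd t u) v)
| teq_addC t u : teq (TAdd t u) (TAdd u t)
| teq_add0 t : teq (TAdd (TCst 0) t) t
| teq_mulA t u v : teq (TMul t (TMul u v)) (TMul (TMul t u) v)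
| teq_mulC t u : teq (TMul t u) (TMul u t)
| teq_mul1 t : teq (TMul (TCst 1) t) t
| teq_mul0 t : teq (TMul (TCst 0) t) (TCst 0)
| teq_mulDl t u v : teq (TMul (TAdd t u) v) (TAdd (TMul t v) (TMul u v))
| teq_cstD a b : teq (TCst (a + b)) (TAdd (TCst a) (TCst b))
| teq_cstM a b : teq (TCst (a * b)) (TMul (TCst a) (TCst b))
| teq_genD i (s s' : S i) : teq (TGen (s + s')) (TAdd (TGen s) (TGen s'))
| teq_genM i (s s' : S i) : teq (TGen (s * s')) (TMul (TGen s) (TGen s'))
| teq_gen_alg i a : teq (TGen (algmap (S i) a)) (TCst a).

HB.instance Definition _ := gen_eqMixin tterm.
HB.instance Definition _ := gen_choiceMixin tterm.

Definition teqb (t u : tterm) : bool := `[< teq t u >].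

Lemma teqb_refl : reflexive teqb.
Proof. by move=> t; apply/asboolP/teq_refl. Qed.
Lemma teqb_sym : symmetric teqb.
Proof. by move=> t u; apply/asboolP/asboolP => /teq_sym. Qed.
Lemma teqb_trans : transitive teqb.
Proof.
by move=> u t v /asboolP tu /asboolP uv; apply/asboolP/(teq_trans tu uv).
Qed.
Canonical teqb_equiv := EquivRel teqb teqb_refl teqb_sym teqb_trans.

Definition tensor := {eq_quot teqb}.
HB.instance Definition _ := Choice.on tensor.

Definition tclass (t : tterm) : tensor := \pi_({eq_quot teqb}) t.

Lemma tclassP t u : tclass t = tclass u <-> teq t u.
Proof. by split=> [/eqmodP/asboolP | tu]; [|apply/eqmodP/asboolP]. Qed.

Lemma tclass_repr (x : tensor) : tclass (repr x) = x.
Proof. exact: reprK. Qed.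

Lemma teq_repr t : teq (repr (tclass t)) t.
Proof. by apply/tclassP; rewrite tclass_repr. Qed.

Definition tzero := tclass (TCst 0).
Definition tone := tclass (TCst 1).
Definition tadd (x y : tensor) := tclass (TAdd (repr x) (repr y)).
Definition tmul (x y : tensor) := tclass (TMul (repr x) (repr y)).
Definition topp (x : tensor) := tmul (tclass (TCst (- 1))) x.

Lemma tclassD t u : tclass (TAdd t u) = tadd (tclass t) (tclass u).
Proof. by apply/tclassP/teq_sym/teq_add; exact: teq_repr. Qed.
Lemma tclassM t u : tclass (TMul t u) = tmul (tclass t) (tclass u).
Proof. by apply/tclassP/teq_sym/teq_mul; exact: teq_repr. Qed.

Lemma taddA : associative tadd.
Proof.
move=> x y z; rewrite -(tclass_repr x) -(tclass_repr y) -(tclass_repr z).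
by rewrite -!tclassD; apply/tclassP/teq_addA.
Qed.
Lemma taddC : commutative tadd.
Proof. by move=> x y; apply/tclassP/teq_addC. Qed.
Lemma tadd0 : left_id tzero tadd.
Proof.
by move=> x; rewrite -(tclass_repr x) -tclassD; apply/tclassP/teq_add0.
Qed.
Lemma tmulA : associative tmul.
Proof.
move=> x y z; rewrite -(tclass_repr x) -(tclass_repr y) -(tclass_repr z).
by rewrite -!tclassM; apply/tclassP/teq_mulA.
Qed.
Lemma tmulC : commutative tmul.
Proof. by move=> x y; apply/tclassP/teq_mulC. Qed.
Lemma tmul1 : left_id tone tmul.
Proof.
by move=> x; rewrite -(tclass_repr x) -tclassM; apply/tclassP/teq_mul1.
Qed.
Lemma tmulDl : left_distributive tmul tadd.
Proof.
move=> x y z; rewrite -(tclass_repr x) -(tclass_repr y) -(tclass_repr z).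
by rewrite -tclassD -!tclassM -tclassD; apply/tclassP/teq_mulDl.
Qed.
Lemma taddN : left_inverse tzero topp tadd.
Proof.
move=> x; rewrite /topp -{2}(tmul1 x) -tmulDl -tclassD.
rewrite -(tclass_repr x) -tclassM; apply/tclassP.
apply: teq_trans (teq_mul0 (repr x)); apply: teq_mul (teq_refl _).
by have := teq_cstD (- 1) 1; rewrite addNr => /teq_sym.
Qed.

HB.instance Definition _ :=
  GRing.isZmodule.Build tensor taddA taddC tadd0 taddN.
HB.instance Definition _ :=
  GRing.Zmodule_isComPzRing.Build tensor tmulA tmulC tmul1 tmulDl.

Definition tcst (a : A) : tensor := tclass (TCst a).

Lemma tcst_is_nmod : nmod_morphism tcst.
Proof.
by split=> // a b; rewrite {1}/tcst -[RHS]tclassD; apply/tclassP/teq_cstD.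
Qed.
Lemma tcst_is_monoid : monoid_morphism tcst.
Proof.
by split=> // a b; rewrite {1}/tcst -[RHS]tclassM; apply/tclassP/teq_cstM.
Qed.
HB.instance Definition _ := GRing.isNmodMorphism.Build A tensor tcst tcst_is_nmod.
HB.instance Definition _ :=
  GRing.isMonoidMorphism.Build A tensor tcst tcst_is_monoid.
HB.instance Definition _ :=
  hasAlgMap.Build A tensor (tcst : {rmorphism A -> tensor}).

Lemma tinj_subproof i : is_alghom (fun s : S i => tclass (TGen s) : tensor).
Proof.
split=> [s s'|s s'|a].
- by rewrite -[RHS]tclassD; apply/tclassP/teq_genD.
- by rewrite -[RHS]tclassM; apply/tclassP/teq_genM.
- exact/tclassP/teq_gen_alg.
Qed.
Definition tinj i : alghom (S i) tensor := AlgHom (tinj_subproof i).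

Section Lift.
Context (R : calgType A) (f : forall i, alghom (S i) R).

Fixpoint tlift_term (t : tterm) : R :=
  match t with
  | TCst a => algmap R a
  | TGen i s => f i s
  | TAdd t u => tlift_term t + tlift_term u
  | TMul t u => tlift_term t * tlift_term u
  end.

Lemma tlift_teq t u : teq t u -> tlift_term t = tlift_term u.
Proof.
elim=> //=; try by move=> *; congruence.
- by move=> *; rewrite addrA.
- by move=> *; rewrite addrC.
- by move=> *; rewrite rmorph0 add0r.
- by move=> *; rewrite mulrA.
- by move=> *; rewrite mulrC.
- by move=> *; rewrite rmorph1 mul1r.
- by move=> *; rewrite rmorph0 mul0r.
- by move=> *; rewrite mulrDl.
- by move=> *; rewrite rmorphD.
- by move=> *; rewrite rmorphM.
- by move=> *; rewrite ahD.
- by move=> *; rewrite ahM.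
- by move=> *; rewrite ah_alg.
Qed.

Definition tlift_fun (x : tensor) : R := tlift_term (repr x).

Lemma tlift_class t : tlift_fun (tclass t) = tlift_term t.
Proof. exact/tlift_teq/teq_repr. Qed.

Lemma tlift_subproof : is_alghom tlift_fun.
Proof. by split=> [x y|x y|a]; exact: tlift_class. Qed.
Definition tlift : alghom tensor R := AlgHom tlift_subproof.

Lemma tlift_tinj i s : tlift (tinj i s) = f i s.
Proof. exact: tlift_class. Qed.

Lemma tlift_unique (g : alghom tensor R) :
  (forall i s, g (tinj i s) = f i s) -> g = tlift.
Proof.
move=> gf; apply: ah_eq => x; rewrite -(tclass_repr x) /= tlift_class.
elim: (repr x) => [a|i s|t IHt u IHu|t IHt u IHu] /=.
- exact: (ah_alg g).
- exact: gf.
- by rewrite tclassD -IHt -IHu; exact: (ahD g).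
- by rewrite tclassM -IHt -IHu; exact: (ahM g).
Qed.

End Lift.

Lemma tensor_ext (R : calgType A) (g h : alghom tensor R) :
  (forall i s, g (tinj i s) = h (tinj i s)) -> g = h.
Proof.
move=> gh; rewrite (tlift_unique (f := fun i => ah_comp h (tinj i)) gh).
by symmetry; exact: tlift_unique.
Qed.

End Tensor.

Arguments tinj {A I} S i.

(** * Birings

    A two-fold tensor power is indexed by [bool], with [true] for the left
    factor; a three-fold one by ['I_3]. *)

Section Biring.
Context (A : comPzRingType).

Definition tsquare (S : calgType A) : calgType A := tensor (fun _ : bool => S).
Definition tcube (S : calgType A) : calgType A := tensor (fun _ : 'I_3 => S).

Definition inl2 (S : calgType A) : alghom S (tsquare S) :=
  tinj (fun _ : bool => S) true.
Definition inr2 (S : calgType A) : alghom S (tsquare S) :=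
  tinj (fun _ : bool => S) false.
Definition in3 (S : calgType A) (i : 'I_3) : alghom S (tcube S) :=
  tinj (fun _ : 'I_3 => S) i.

Definition copair (S R : calgType A) (f g : alghom S R) :
    alghom (tsquare S) R :=
  tlift (fun b : bool => if b then f else g).

Definition tsquare_map (S T : calgType A) (f : alghom S T) :
    alghom (tsquare S) (tsquare T) :=
  copair (ah_comp (inl2 T) f) (ah_comp (inr2 T) f).

(** The operation on [Hom_A(S, R)] dual to [delta]. A law of [B]-algebras in
    [n] variables is dualized by requiring it of the operations on
    [Hom_A(S, R)], where [R] is the [n]-th tensor power of [S], at the [n]
    canonical maps from [S] to [R]. *)
Definition coop (S : calgType A) (delta : alghom S (tsquare S))
    (R : calgType A) (f g : alghom S R) : alghom S R :=
  ah_comp (copair f g) delta.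

(** A [B]-algebra is a ring with a ring homomorphism from [B], so [colin 0] and
    [colin 1] are the counits of [coadd] and [comul]. *)
Record biring (B : comPzRingType) (S : calgType A) := Biring {
  coadd : alghom S (tsquare S);
  comul : alghom S (tsquare S);
  colin : B -> alghom S A^o;
  coaddA : let x := in3 S 0 in let y := in3 S 1 in let z := in3 S 2 in
    coop coadd x (coop coadd y z) = coop coadd (coop coadd x y) z;
  coaddC : coop coadd (inl2 S) (inr2 S) = coop coadd (inr2 S) (inl2 S);
  coadd0 : coop coadd (ah_comp (ah_unit S) (colin 0)) (ah_id S) = ah_id S;
  coaddN : exists sigma : alghom S S,
    coop coadd sigma (ah_id S) = ah_comp (ah_unit S) (colin 0);
  comulA : let x := in3 S 0 in let y := in3 S 1 in let z := in3 S 2 in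
    coop comul x (coop comul y z) = coop comul (coop comul x y) z;
  comulC : coop comul (inl2 S) (inr2 S) = coop comul (inr2 S) (inl2 S);
  comul1 : coop comul (ah_comp (ah_unit S) (colin 1)) (ah_id S) = ah_id S;
  comulDl : let x := in3 S 0 in let y := in3 S 1 in let z := in3 S 2 in
    coop comul (coop coadd x y) z
      = coop coadd (coop comul x z) (coop comul y z);
  colinD : forall b c, colin (b + c) = coop coadd (colin b) (colin c);
  colinM : forall b c, colin (b * c) = coop comul (colin b) (colin c) }.

Definition biring_hom (B : comPzRingType) (S T : calgType A)
    (sS : biring B S) (sT : biring B T) (phi : alghom S T) : Prop :=
  [/\ ah_comp (coadd sT) phi = ah_comp (tsquare_map phi) (coadd sS),
      ah_comp (comul sT) phi = ah_comp (tsquare_map phi) (comul sS)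
    & forall b, ah_comp (colin sT b) phi = colin sS b].

Lemma copair_inl (S R : calgType A) (f g : alghom S R) s :
  copair f g (inl2 S s) = f s.
Proof. exact: (tlift_tinj (S := fun _ : bool => S)). Qed.
Lemma copair_inr (S R : calgType A) (f g : alghom S R) s :
  copair f g (inr2 S s) = g s.
Proof. exact: (tlift_tinj (S := fun _ : bool => S)). Qed.

End Biring.

(** * The biring [A[X]] *)

Section PolyBiring.
Context (A : comNzRingType).

Section Eval.
Context (R : calgType A) (x : R).

Definition peval_fun (p : {poly A}) : R :=
  \sum_(i < size p) algmap R p`_i * x ^+ i.

Lemma peval_wide n (p : {poly A}) : (size p <= n)%N ->
  peval_fun p = \sum_(i < n) algmap R p`_i * x ^+ i.
Proof.
move=> le_pn; rewrite /peval_fun (big_ord_widen _ (fun i => algmap R p`_i * x ^+ i) le_pn).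
rewrite big_mkcond; apply: eq_bigr => i _; case: ltnP => // le_pi.
by rewrite (nth_default 0 le_pi) rmorph0 mul0r.
Qed.

Lemma pevalD : {morph peval_fun : p q / p + q}.
Proof.
move=> p q; pose n := maxn (size p) (size q).
rewrite !(@peval_wide n) ?leq_maxl ?leq_maxr ?size_polyD // -big_split /=.
by apply: eq_bigr => i _; rewrite coefD rmorphD mulrDl.
Qed.

Lemma pevalC a : peval_fun a%:P = algmap R a.
Proof.
by rewrite (@peval_wide 1) ?size_polyC_leq1 // big_ord1 coefC mulr1.
Qed.

Lemma pevalCM a p : peval_fun (a%:P * p) = algmap R a * peval_fun p.
Proof.
rewrite (@peval_wide (size p)); last first.
  by rewrite mul_polyC size_scale_leq.
rewrite /peval_fun mulr_sumr; apply: eq_bigr => i _.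
by rewrite coefCM rmorphM mulrA.
Qed.

Lemma pevalMX p : peval_fun (p * 'X) = peval_fun p * x.
Proof.
rewrite (@peval_wide (size p).+1).
  rewrite big_ord_recl coefMX rmorph0 mul0r add0r /peval_fun mulr_suml.
  by apply: eq_bigr => i _; rewrite coefMX /= exprSr mulrA.
by rewrite (leq_trans (size_polyMleq _ _)) // size_polyX addn2.
Qed.

Lemma pevalM : {morph peval_fun : p q / p * q}.
Proof.
move=> p q; elim/poly_ind: p => [|p a IHp].
  by rewrite mul0r -[0]/(0%:P) pevalC rmorph0 mul0r.
rewrite mulrDl !pevalD pevalCM mulrAC !pevalMX pevalC IHp.
by rewrite mulrDl mulrAC.
Qed.

Lemma peval_subproof : is_alghom peval_fun.
Proof. by split; [exact: pevalD | exact: pevalM | exact: pevalC]. Qed.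
Definition peval : alghom {poly A} R := AlgHom peval_subproof.

Lemma pevalX : peval 'X = x.
Proof.
have := pevalMX 1; rewrite mul1r => /= ->.
by rewrite -[1]/(1%:P) pevalC rmorph1 mul1r.
Qed.

End Eval.

Lemma poly_ext (R : calgType A) (f g : alghom {poly A} R) :
  f 'X = g 'X -> f = g.
Proof.
move=> fgX; apply: ah_eq; elim/poly_ind => [|p a IHp]; first by rewrite !ah0.
by rewrite !ahD !ahM IHp fgX -[a%:P]/(algmap {poly A} a) !ah_alg.
Qed.

Definition poly_coadd : alghom {poly A} (tsquare {poly A}) :=
  peval (inl2 {poly A} 'X + inr2 {poly A} 'X).
Definition poly_comul : alghom {poly A} (tsquare {poly A}) :=
  peval (inl2 {poly A} 'X * inr2 {poly A} 'X).

Lemma poly_colin_subproof (a : A) :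
  is_alghom (fun p : {poly A} => p.[a] : A^o).
Proof.
by split=> [p q|p q|b]; [exact: hornerD | exact: hornerM | exact: hornerC].
Qed.
Definition poly_colin (a : A) : alghom {poly A} A^o :=
  AlgHom (poly_colin_subproof a).

Lemma poly_coaddX (R : calgType A) (f g : alghom {poly A} R) :
  coop poly_coadd f g 'X = f 'X + g 'X.
Proof.
rewrite [LHS](_ : _ = copair f g (poly_coadd 'X)) // pevalX ahD.
by rewrite copair_inl copair_inr.
Qed.
Lemma poly_comulX (R : calgType A) (f g : alghom {poly A} R) :
  coop poly_comul f g 'X = f 'X * g 'X.
Proof.
rewrite [LHS](_ : _ = copair f g (poly_comul 'X)) // pevalX ahM.
by rewrite copair_inl copair_inr.
Qed.

Definition poly_biring : biring A {poly A}.
Proof.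
apply: (@Biring A A {poly A} poly_coadd poly_comul poly_colin).
- by move=> x y z; apply: poly_ext; rewrite !poly_coaddX addrA.
- by apply: poly_ext; rewrite !poly_coaddX addrC.
- apply: poly_ext; rewrite poly_coaddX /= hornerX.
  by rewrite (rmorph0 (algmap {poly A})) add0r.
- exists (peval (- 'X : {poly A})); apply: poly_ext.
  rewrite poly_coaddX pevalX /= hornerX addNr.
  by rewrite (rmorph0 (algmap {poly A})).
- by move=> x y z; apply: poly_ext; rewrite !poly_comulX mulrA.
- by apply: poly_ext; rewrite !poly_comulX mulrC.
- apply: poly_ext; rewrite poly_comulX /= hornerX.
  by rewrite (rmorph1 (algmap {poly A})) mul1r.
- move=> x y z; apply: poly_ext.
  by rewrite !poly_comulX !poly_coaddX !poly_comulX mulrDl.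
- by move=> b c; apply: poly_ext; rewrite poly_coaddX /= !hornerX.
- by move=> b c; apply: poly_ext; rewrite poly_comulX /= !hornerX.
Defined.

End PolyBiring.

(** * Integer-valued polynomials *)

Local Notation "x %:F" := (@tofrac _ x) : ring_scope.

Section Int.
Context (D : idomainType).
Local Notation K := {fraction D}.

Definition int_valued : {pred {poly K}} := fun f =>
  `[< forall a : D, exists b : D, f.[a%:F] = b%:F >].

Record Int := MkInt { int_val :> {poly K}; _ : int_val \in int_valued }.

HB.instance Definition _ := [isSub for int_val].
HB.instance Definition _ := [Choice of Int by <:].

Lemma int_valuedP (f : {poly K}) :
  reflect (forall a : D, exists b : D, f.[a%:F] = b%:F) (f \in int_valued).
Proof. exact: asboolP. Qed.

Lemma int_valued_closed : subring_closed int_valued.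
Proof.
split.
- by apply/int_valuedP => a; exists 1; rewrite hornerC rmorph1.
- move=> f g /int_valuedP fP /int_valuedP gP; apply/int_valuedP => a.
  have [b fb] := fP a; have [c gc] := gP a.
  by exists (b - c); rewrite hornerD hornerN fb gc rmorphB.
- move=> f g /int_valuedP fP /int_valuedP gP; apply/int_valuedP => a.
  have [b fb] := fP a; have [c gc] := gP a.
  by exists (b * c); rewrite hornerM fb gc rmorphM.
Qed.

HB.instance Definition _ :=
  GRing.isSubringClosed.Build {poly K} int_valued int_valued_closed.
HB.instance Definition _ := [SubChoice_isSubComNzRing of Int by <:].

Lemma int_cst_subproof (a : D) : (a%:F)%:P \in int_valued.
Proof. by apply/int_valuedP => b; exists a; rewrite hornerC. Qed.
Definition int_cst (a : D) : Int := MkInt (int_cst_subproof a).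

Lemma int_cst_is_nmod : nmod_morphism int_cst.
Proof. by split=> [|a b]; apply: val_inj; rewrite /= ?rmorph0 ?rmorphD. Qed.
Lemma int_cst_is_monoid : monoid_morphism int_cst.
Proof. by split=> [|a b]; apply: val_inj; rewrite /= ?rmorph1 ?rmorphM. Qed.
HB.instance Definition _ :=
  GRing.isNmodMorphism.Build D Int int_cst int_cst_is_nmod.
HB.instance Definition _ :=
  GRing.isMonoidMorphism.Build D Int int_cst int_cst_is_monoid.
HB.instance Definition _ :=
  hasAlgMap.Build D Int (int_cst : {rmorphism D -> Int}).

Lemma int_incl_subproof (p : {poly D}) : map_poly (@tofrac D) p \in int_valued.
Proof. by apply/int_valuedP => a; exists p.[a]; rewrite horner_map. Qed.

Lemma int_incl_alghom :
  is_alghom (fun p : {poly D} => MkInt (int_incl_subproof p)).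
Proof.
by split=> [p q|p q|a]; apply: val_inj; rewrite /= ?rmorphD ?rmorphM //= map_polyC.
Qed.
Definition int_incl : alghom {poly D} Int := AlgHom int_incl_alghom.

End Int.

(** [K[X]] for a set [X] of variables is the monoid algebra over [K] of the
    free commutative monoid on [X]. *)
Section IntX.
Context (D : idomainType) (X : choiceType).
Local Notation K := {fraction D}.
Local Notation KX := {malg K[{cmonom X}]}.

Definition cmeval (v : X -> K) (m : {cmonom X}) : K :=
  \prod_(x <- finsupp m) v x ^+ m x.

Lemma cmevalEw (v : X -> K) (m : {cmonom X}) (d : {fset X}) :
  (finsupp m `<=` d)%fset -> cmeval v m = \prod_(x <- d) v x ^+ m x.
Proof.
move=> le_md; rewrite /cmeval (big_fset_incl _ le_md) // => x _.
by rewrite -cmE_eq0 => /eqP ->; rewrite expr0.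
Qed.

Lemma cmeval_is_mmorphism v : mmorphism (cmeval v).
Proof.
split=> [m n|]; last by rewrite /cmeval mdom1 big_seq_fset0.
pose d := finsupp (mmul m n).
have le_m : (finsupp m `<=` d)%fset by rewrite /d mdomD fsubsetUl.
have le_n : (finsupp n `<=` d)%fset by rewrite /d mdomD fsubsetUr.
rewrite {1}/cmeval (cmevalEw v le_m) (cmevalEw v le_n) -big_split /=.
by apply: eq_bigr => x _; rewrite cmM exprD.
Qed.
HB.instance Definition _ v :=
  isMultiplicative.Build {cmonom X} K (cmeval v) (cmeval_is_mmorphism v).

Definition meval (v : X -> K) (f : KX) : K := mmap idfun (cmeval v) f.
Lemma meval_is_nmod v : nmod_morphism (meval v).
Proof. by split=> [|f g]; [exact: raddf0 | exact: raddfD]. Qed.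
Lemma meval_is_monoid v : monoid_morphism (meval v).
Proof. by split=> [|f g]; [exact: rmorph1 | exact: rmorphM]. Qed.
HB.instance Definition _ v :=
  GRing.isNmodMorphism.Build KX K (meval v) (meval_is_nmod v).
HB.instance Definition _ v :=
  GRing.isMonoidMorphism.Build KX K (meval v) (meval_is_monoid v).

Definition intX_valued : {pred KX} := fun f =>
  `[< forall a : X -> D, exists b : D, meval (fun x => (a x)%:F) f = b%:F >].

Record IntX := MkIntX { intX_val :> KX; _ : intX_val \in intX_valued }.

HB.instance Definition _ := [isSub for intX_val].
HB.instance Definition _ := [Choice of IntX by <:].

Lemma intX_valuedP (f : KX) :
  reflect (forall a : X -> D, exists b : D, meval (fun x => (a x)%:F) f = b%:F)
          (f \in intX_valued).
Proof. exact: asboolP. Qed.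

Lemma intX_valued_closed : subring_closed intX_valued.
Proof.
split.
- by apply/intX_valuedP => a; exists 1; rewrite !rmorph1.
- move=> f g /intX_valuedP fP /intX_valuedP gP; apply/intX_valuedP => a.
  have [b fb] := fP a; have [c gc] := gP a.
  by exists (b - c); rewrite !rmorphB /= fb gc.
- move=> f g /intX_valuedP fP /intX_valuedP gP; apply/intX_valuedP => a.
  have [b fb] := fP a; have [c gc] := gP a.
  by exists (b * c); rewrite !rmorphM /= fb gc.
Qed.

HB.instance Definition _ :=
  GRing.isSubringClosed.Build KX intX_valued intX_valued_closed.
HB.instance Definition _ := [SubChoice_isSubComNzRing of IntX by <:].

Lemma meval_malgC v (c : K) : meval v (malgC c) = c.
Proof. exact: mmapC. Qed.

Lemma meval_var v (x : X) : meval v << ucm x >> = v x.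
Proof.
by rewrite /meval mmapU mul1r /= /cmeval mdomU big_seq_fset1 cmUU expr1.
Qed.

Lemma intX_cst_subproof (a : D) : malgC (a%:F) \in intX_valued.
Proof. by apply/intX_valuedP => b; exists a; rewrite meval_malgC. Qed.
Definition intX_cst (a : D) : IntX := MkIntX (intX_cst_subproof a).

Lemma intX_cst_is_nmod : nmod_morphism intX_cst.
Proof. by split=> [|a b]; apply: val_inj; rewrite /= ?rmorph0 ?rmorphD. Qed.
Lemma intX_cst_is_monoid : monoid_morphism intX_cst.
Proof. by split=> [|a b]; apply: val_inj; rewrite /= ?rmorph1 ?rmorphM. Qed.
HB.instance Definition _ :=
  GRing.isNmodMorphism.Build D IntX intX_cst intX_cst_is_nmod.
HB.instance Definition _ :=
  GRing.isMonoidMorphism.Build D IntX intX_cst intX_cst_is_monoid.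
HB.instance Definition _ :=
  hasAlgMap.Build D IntX (intX_cst : {rmorphism D -> IntX}).

Definition subst_var (x : X) (f : {poly K}) : KX :=
  (map_poly (@malgC {cmonom X} K) f).[<< ucm x >>].

Lemma meval_subst_var v x f : meval v (subst_var x f) = f.[v x].
Proof.
rewrite /subst_var -horner_map /= meval_var -map_poly_comp.
by congr (_.[_]); apply: map_poly_id => c _; exact: meval_malgC.
Qed.

Lemma int_subst_subproof x (f : Int D) : subst_var x f \in intX_valued.
Proof.
apply/intX_valuedP => a; have /int_valuedP/(_ (a x)) [b fb] := valP f.
by exists b; rewrite meval_subst_var.
Qed.

Lemma int_subst_alghom x :
  is_alghom (fun f : Int D => MkIntX (int_subst_subproof x f)).
Proof.
split=> [f g|f g|a]; apply: val_inj; rewrite /= /subst_var.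
- by rewrite rmorphD hornerD.
- by rewrite rmorphM hornerM.
- by rewrite map_polyC hornerC.
Qed.
Definition int_subst x : alghom (Int D) IntX := AlgHom (int_subst_alghom x).

Definition theta : alghom (tensor (fun _ : X => Int D)) IntX :=
  tlift (S := fun _ : X => Int D) int_subst.

End IntX.

Definition polynomially_composite (D : idomainType) : Prop :=
  forall X : choiceType, bijective (@theta D X).

(** * Krull domains and TV PVMDs *)

Section DomainClasses.
Context (D : idomainType).
Local Notation K := {fraction D}.
Local Open Scope classical_set_scope.

Definition intg : set K := range (@tofrac D).

(** The value of a valuation at [0] is irrelevant. *)
Definition discrete_valuation (v : K -> int) : Prop :=
  [/\ forall x y, x != 0 -> y != 0 -> v (x * y) = v x + v y,
      forall x y, x != 0 -> y != 0 -> x + y != 0 ->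
        Num.min (v x) (v y) <= v (x + y)
    & exists2 x, x != 0 & v x = 1].

Definition krull_domain : Prop :=
  exists V : set (K -> int),
    [/\ forall v, V v -> discrete_valuation v,
        forall x, x != 0 -> (intg x <-> forall v, V v -> 0 <= v x)
      & forall x, x != 0 -> finite_set [set v | V v /\ v x != 0]].

Definition dspan (s : seq K) : set K :=
  [set x | exists c : nat -> D, x = \sum_(i < size s) (c i)%:F * s`_i].

Definition dideal (I : set K) : Prop :=
  [/\ I `<=` intg, I 0, forall x y, I x -> I y -> I (x + y)
    & forall (a : D) x, I x -> I (a%:F * x)].

Definition nonzero (I : set K) : Prop := exists2 x, I x & x != 0.

Definition finv (I : set K) : set K :=
  [set x | forall y, I y -> intg (x * y)].

Definition vclosure (I : set K) : set K := finv (finv I).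

Definition tclosure (I : set K) : set K :=
  [set x | exists s, [/\ dspan s `<=` I, nonzero (dspan s)
                       & vclosure (dspan s) x]].

Definition idmul (I J : set K) : set K :=
  [set x | exists s : seq (K * K),
     (forall p, p \in s -> I p.1 /\ J p.2) /\ x = \sum_(p <- s) p.1 * p.2].

Definition PVMD : Prop :=
  forall I, dideal I -> nonzero I -> (exists s, I = dspan s) ->
  tclosure (idmul I (finv I)) = intg.

Definition TV_domain : Prop :=
  forall I, dideal I -> nonzero I -> tclosure I = vclosure I.

Definition TV_PVMD : Prop := PVMD /\ TV_domain.

End DomainClasses.

(* Main.v *)
From HB Require Import structures.
Require Import Defs.
From mathcomp Require Import all_boot all_order all_algebra.
From mathcomp Require Import finmap monalg zify ring.
From mathcomp Require Import boolp classical_sets cardinality.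

(** Let [D] be polynomially composite. Then the tensor powers of [Int(D)] embed
    into polynomial rings over the quotient field, so they are torsion-free, and
    a homomorphism from [Int(D)] to a torsion-free [D]-algebra is determined by
    the image of [X], as every integer-valued polynomial has a multiple in
    [D[X]]. Hence the biring structure is unique, and its laws need only be
    checked at [X]. It exists because [f(X + Y)] and [f(XY)] are integer-valued,
    hence in the image of [Int(D) (x) Int(D)].

    [D] is polynomially composite as soon as, for every [N], the module of
    integer-valued polynomials of degree [< N] has a finite dual basis: expand
    both tensors and integer-valued polynomials in several variables along it.
    The [s] for which the dual basis identity holds up to the factor [s] form an
    ideal, so it is enough to find one outside each maximal ideal [M]. If some
    common denominator [s] of these polynomials is not in [M], then the powers
    of [X] do. Otherwise [M] contains the Vandermonde determinants of [N]
    elements of [D]; taking them at the powers of an [x] in [M] shows that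
    a power of [x] is locally a common denominator, so that every finite subset
    of [M] is multiplied into [D] by some [b] in [K] not in [D]. In both a Krull
    domain and a TV PVMD this implies that [b M] is in [D] for a single such
    [b], and that [M] is locally generated by one element [p]. Newton
    interpolation at a [p]-ordering then gives the dual basis. *)

Import GRing.Theory Num.Theory Order.TTheory.

Set Implicit Arguments.
Unset Strict Implicit.
Unset Printing Implicit Defensive.

Local Open Scope ring_scope.

Local Notation "x %:F" := (@tofrac _ x) : ring_scope.

(** * Homomorphisms from [Int(D)] to torsion-free algebras *)

Section TorsionFree.
Context (D : idomainType).
Local Notation K := {fraction D}.

Definition torsion_free (R : calgType D) : Prop :=
  forall (d : D) (x : R), d != 0 -> algmap R d * x = 0 -> x = 0.

Lemma torsion_free_inj (R : calgType D) d (x y : R) : torsion_free R ->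
  d != 0 -> algmap R d * x = algmap R d * y -> x = y.
Proof.
move=> tfR d0 /eqP; rewrite -subr_eq0 -mulrBr => /eqP /(tfR _ _ d0) /eqP.
by rewrite subr_eq0 => /eqP.
Qed.

Lemma frac_repr (x : K) : exists a b : D, b != 0 /\ b%:F * x = a%:F.
Proof.
elim/quotW: x => x; exists \n_x, \d_x; split; first exact: denom_ratioP.
unlock tofrac; rewrite -[LHS]FracField.pi_mul; apply/eqmodP/eqP => /=.
by rewrite /FracField.mulf /= !numden_Ratio ?mul1r ?mulr1 ?oner_neq0 ?denom_ratioP.
Qed.

Lemma clear_denominators (f : {poly K}) :
  exists (d : D) (p : {poly D}), d != 0 /\ d%:F *: f = map_poly (@tofrac D) p.
Proof.
elim/poly_ind: f => [|f c [d [p [d0 dp]]]].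
  by exists 1, 0; rewrite oner_neq0 scaler0 rmorph0.
have [a [b [b0 bc]]] := frac_repr c.
exists (b * d), (b%:P * p * 'X + (d * a)%:P); split; first by rewrite mulf_neq0.
rewrite rmorphD !rmorphM /= map_polyX !map_polyC /= -dp scalerDr.
congr (_ + _); first by rewrite mul_polyC -scalerA !scalerAl.
by rewrite -mul_polyC -!polyCM mulrAC bc mulrC.
Qed.

Lemma int_clear_denominators (f : Int D) :
  exists (d : D) (p : {poly D}),
    d != 0 /\ algmap (Int D) d * f = int_incl D p.
Proof.
have [d [p [d0 dp]]] := clear_denominators f.
by exists d, p; split=> //; apply: val_inj; rewrite /= -dp -mul_polyC.
Qed.

Lemma alghom_int_ext (R : calgType D) (f g : alghom (Int D) R) :
  torsion_free R -> f (int_incl D 'X) = g (int_incl D 'X) -> f = g.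
Proof.
move=> tfR fgX.
have fg : ah_comp f (int_incl D) = ah_comp g (int_incl D) by exact: poly_ext.
apply: ah_eq => h; have [d [p [d0 dp]]] := int_clear_denominators h.
apply: (torsion_free_inj tfR d0).
rewrite -{1}(ah_alg f) -(ah_alg g) -!ahM dp.
by have := congr1 (fun k : alghom _ _ => k p) fg.
Qed.

(** The image of [f] must be the unique [t] with [d t = p(y)], where [d f = p]. These pairs form a
    relation compatible with the ring operations, and torsion-freeness makes it a function. *)
Lemma alghom_int_exists (R : calgType D) (y : R) : torsion_free R ->
  (forall f : Int D, exists (d : D) (p : {poly D}) (t : R),
     [/\ d != 0, algmap (Int D) d * f = int_incl D p
       & algmap R d * t = peval y p]) ->
  exists h : alghom (Int D) R, h (int_incl D 'X) = y.
Proof.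
move=> tfR ex_t.
pose P (f : Int D) (t : R) := exists (d : D) (p : {poly D}),
  [/\ d != 0, algmap (Int D) d * f = int_incl D p & algmap R d * t = peval y p].
have {ex_t} /choice [h hP] : forall f, exists t, P f t.
  by move=> f; have [d [p [t tP]]] := ex_t f; exists t, d, p.
have incl_inj : injective (int_incl D).
  move=> p q /(congr1 val) /polyP pq; apply/polyP => i; have := pq i.
  by rewrite !coef_map /= => /eqP; rewrite tofrac_eq => /eqP.
(* Cross-multiplying the two presentations of [f] gives [e p = d q] already in [D[X]]. *)
have Pfun f t u : P f t -> P f u -> t = u.
  move=> [d [p [d0 dp dt]]] [e [q [e0 eq eu]]].
  apply: (torsion_free_inj tfR (mulf_neq0 d0 e0)).
  have pq : algmap {poly D} e * p = algmap {poly D} d * q.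
    by apply: incl_inj; rewrite !ahM !ah_alg -dp -eq mulrCA.
  rewrite rmorphM mulrAC dt -mulrA eu mulrC.
  by rewrite -!(ah_alg (peval y)) -!ahM pq.
have PD f g t u : P f t -> P g u -> P (f + g) (t + u).
  move=> [d [p [d0 dp dt]]] [e [q [e0 eq eu]]].
  exists (d * e), (algmap {poly D} e * p + algmap {poly D} d * q).
  rewrite mulf_neq0 //; split=> //.
    rewrite ahD !ahM !ah_alg -dp -eq rmorphM mulrDr; congr (_ + _).
      by rewrite mulrAC mulrC.
    by rewrite mulrA.
  rewrite ahD !ahM !ah_alg -dt -eu rmorphM mulrDr; congr (_ + _).
    by rewrite mulrAC mulrC.
  by rewrite mulrA.
have PM f g t u : P f t -> P g u -> P (f * g) (t * u).
  move=> [d [p [d0 dp dt]]] [e [q [e0 eq eu]]].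
  exists (d * e), (p * q); rewrite mulf_neq0 //; split=> //.
    by rewrite ahM -dp -eq rmorphM mulrACA.
  by rewrite ahM -dt -eu rmorphM mulrACA.
have Palg a : P (algmap (Int D) a) (algmap R a).
  exists 1, (algmap {poly D} a); rewrite oner_neq0 !rmorph1 !mul1r; split=> //.
    by rewrite ah_alg.
  by rewrite ah_alg.
have h_hom : is_alghom (h : Int D -> R).
  split=> [f g|f g|a]; apply: Pfun (hP _) _; [exact: PD|exact: PM|exact: Palg].
exists (AlgHom h_hom); apply: Pfun (hP _) _.
by exists 1, 'X; rewrite oner_neq0 !rmorph1 !mul1r pevalX.
Qed.

End TorsionFree.

(** * The biring structure of a polynomially composite domain *)

Section Composite.
Context (D : idomainType).
Local Notation K := {fraction D}.

Lemma ah_peval (R S : calgType D) (h : alghom R S) (y : R) (p : {poly D}) :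
  h (peval y p) = peval (h y) p.
Proof.
rewrite -[LHS]/(ah_comp h (peval y) p); congr (ah_fun _ _); apply: poly_ext.
by rewrite pevalX -[LHS]/(h (peval y 'X)) pevalX.
Qed.

Lemma torsion_free_base : torsion_free (D^o : calgType D).
Proof. by move=> d x d0 /eqP; rewrite mulf_eq0 (negbTE d0) => /eqP. Qed.

Lemma torsion_free_int : torsion_free (Int D).
Proof.
move=> d f d0 /(congr1 val) /= /eqP.
by rewrite mulf_eq0 polyC_eq0 tofrac_eq0 (negbTE d0) => /eqP f0; apply: val_inj.
Qed.

Lemma torsion_free_intX (X : choiceType) : torsion_free (IntX D X).
Proof.
move=> d f d0 /(congr1 val) /= /malgP df0; apply: val_inj; apply/malgP => m.
have /eqP := df0 m; rewrite mcoeffCM mcoeff0 mulf_eq0 tofrac_eq0 (negbTE d0).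
by move=> /eqP ->.
Qed.

Lemma torsion_free_mono (R S : calgType D) (h : alghom R S) :
  injective h -> torsion_free S -> torsion_free R.
Proof.
move=> h_inj tfS d x d0 dx; apply: h_inj; rewrite ah0; apply: (tfS d) => //.
by rewrite -(ah_alg h) -ahM dx ah0.
Qed.

Lemma int_comp_subproof (y f : Int D) : val f \Po val y \in @int_valued D.
Proof.
apply/int_valuedP => a; have /int_valuedP /(_ a) [c yc] := valP y.
by have /int_valuedP /(_ c) [b fb] := valP f; exists b; rewrite horner_comp yc.
Qed.

Lemma int_comp_alghom (y : Int D) :
  is_alghom (fun f => MkInt (int_comp_subproof y f)).
Proof.
split=> [f g|f g|a]; apply: val_inj; rewrite /=.
- by rewrite rmorphD.
- by rewrite rmorphM.
- by rewrite comp_polyC.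
Qed.

Lemma intX_comp_subproof (X : choiceType) (y : IntX D X) (f : Int D) :
  (map_poly (@malgC {cmonom X} K) f).[val y] \in @intX_valued D X.
Proof.
apply/intX_valuedP => a; have /intX_valuedP /(_ a) [c yc] := valP y.
have /int_valuedP /(_ c) [b fb] := valP f; exists b.
rewrite -fb -horner_map /= -map_poly_comp yc; congr (_.[_]).
by apply: map_poly_id => k _; exact: meval_malgC.
Qed.

Definition intX_comp (X : choiceType) (y : IntX D X) (f : Int D) : IntX D X :=
  MkIntX (intX_comp_subproof y f).

Lemma intX_comp_alghom (X : choiceType) (y : IntX D X) :
  is_alghom (intX_comp y).
Proof.
split=> [f g|f g|a]; apply: val_inj; rewrite /=.
- by rewrite rmorphD hornerD.
- by rewrite rmorphM hornerM.
- by rewrite map_polyC hornerC.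
Qed.

Lemma intX_comp_incl (X : choiceType) (y : IntX D X) (p : {poly D}) :
  intX_comp y (int_incl D p) = peval y p.
Proof.
pose h := ah_comp (AlgHom (intX_comp_alghom y)) (int_incl D).
have -> : intX_comp y (int_incl D p) = h p by [].
rewrite (_ : h = peval y) //; apply: poly_ext; rewrite pevalX.
by apply: val_inj; rewrite /= !map_polyX hornerX.
Qed.

Hypothesis compD : polynomially_composite D.

Lemma torsion_free_tensor (X : choiceType) :
  torsion_free (tensor (fun _ : X => Int D)).
Proof.
exact: torsion_free_mono (bij_inj (@compD X)) (@torsion_free_intX X).
Qed.

(** The required [t] is the preimage under [theta] of [f] composed with [theta y], which is again
    integer-valued. *)
Lemma tensor_alghom_exists (X : choiceType) (y : tensor (fun _ : X => Int D)) :
  exists h : alghom (Int D) (tensor (fun _ : X => Int D)),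
    h (int_incl D 'X) = y.
Proof.
apply: alghom_int_exists; first exact: torsion_free_tensor.
move=> f; have [d [p [d0 dp]]] := int_clear_denominators f.
have [g gK Kg] := @compD X.
exists d, p, (g (intX_comp (theta D X y) f)); split=> //.
apply: (bij_inj (@compD X)); rewrite ahM ah_alg Kg.
pose h := AlgHom (intX_comp_alghom (theta D X y)).
rewrite -(ah_alg h) -[intX_comp _ f]/(h f) -ahM dp [LHS]intX_comp_incl.
by rewrite ah_peval.
Qed.

Lemma biring_eq (A : comPzRingType) (B : comPzRingType) (S : calgType A)
    (b c : biring B S) :
  coadd b = coadd c -> comul b = comul c -> colin b =1 colin c -> b = c.
Proof.
case: b => [? ? ? ? ? ? ? ? ? ? ? ? ?]; case: c => [? ? ? ? ? ? ? ? ? ? ? ? ?] /=.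
move=> ea em /funext el; subst; congr Biring; exact: Prop_irrelevance.
Qed.

Lemma biring_hom_int_unique (b c : biring D (Int D)) :
  biring_hom (poly_biring D) b (int_incl D) ->
  biring_hom (poly_biring D) c (int_incl D) -> b = c.
Proof.
have tf2 : torsion_free (tsquare (Int D)) by exact: torsion_free_tensor.
move=> [ba bm bl] [ca cm cl]; apply: biring_eq => [||a].
- apply: alghom_int_ext => //.
  by have /(congr1 (fun h : alghom _ _ => h 'X)) := etrans ba (esym ca).
- apply: alghom_int_ext => //.
  by have /(congr1 (fun h : alghom _ _ => h 'X)) := etrans bm (esym cm).
- apply: alghom_int_ext; first exact: torsion_free_base.
  by have /(congr1 (fun h : alghom _ _ => h 'X)) := etrans (bl a) (esym (cl a)).
Qed.

Lemma int_colin_subproof (a : D) :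
  exists h : alghom (Int D) D^o, h (int_incl D 'X) = a.
Proof.
apply: alghom_int_exists; first exact: torsion_free_base.
move=> f; have [d [p [d0 dp]]] := int_clear_denominators f.
have /int_valuedP /(_ a) [t ft] := valP f.
exists d, p, (t : D^o); split=> //.
have dt : d * t = p.[a].
  have /(congr1 (fun q : Int D => (val q).[a%:F])) /= := dp.
  rewrite hornerM hornerC horner_map ft -tofracM /= => /eqP.
  by rewrite tofrac_eq => /eqP.
apply: (etrans dt); rewrite -[LHS]/(poly_colin a p).
suff -> : poly_colin a = peval (a : D^o) by [].
by apply: poly_ext; rewrite pevalX /= hornerX.
Qed.

Lemma composite_biring_exists :
  exists b : biring D (Int D), biring_hom (poly_biring D) b (int_incl D).
Proof.
pose X := int_incl D 'X.
have tf2 : torsion_free (tsquare (Int D)) by exact: torsion_free_tensor.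
have tf3 : torsion_free (tcube (Int D)) by exact: torsion_free_tensor.
have tfI := torsion_free_int.
have tfD := torsion_free_base.
have [da daX] := tensor_alghom_exists (inl2 _ X + inr2 _ X).
have [dm dmX] := tensor_alghom_exists (inl2 _ X * inr2 _ X).
have [l lX] := choice int_colin_subproof.
have addX (R : calgType D) (f g : alghom (Int D) R) : coop da f g X = f X + g X.
  rewrite [LHS](_ : _ = copair f g (da X)) // daX ahD.
  by rewrite copair_inl copair_inr.
have mulX (R : calgType D) (f g : alghom (Int D) R) : coop dm f g X = f X * g X.
  rewrite [LHS](_ : _ = copair f g (dm X)) // dmX ahM.
  by rewrite copair_inl copair_inr.
have unitX a : ah_comp (ah_unit (Int D)) (l a) X = algmap (Int D) a.
  by rewrite /= lX.
(* The co-inverse is the substitution of [- X] for [X]. *)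
have [sg sgX] : exists h : alghom (Int D) (Int D), h X = - X.
  exists (AlgHom (int_comp_alghom (- X))); apply: val_inj.
  by rewrite /= !map_polyX comp_polyX.
unshelve eexists.
  apply: (@Biring D D (Int D) da dm l).
  - by move=> x y z; apply: alghom_int_ext => //; rewrite !addX addrA.
  - by apply: alghom_int_ext => //; rewrite !addX addrC.
  - by apply: alghom_int_ext => //; rewrite addX unitX rmorph0 add0r.
  - exists sg; apply: alghom_int_ext => //.
    by rewrite addX unitX sgX addNr rmorph0.
  - by move=> x y z; apply: alghom_int_ext => //; rewrite !mulX mulrA.
  - by apply: alghom_int_ext => //; rewrite !mulX mulrC.
  - by apply: alghom_int_ext => //; rewrite mulX unitX rmorph1 mul1r.
  - move=> x y z; apply: alghom_int_ext => //.
    by rewrite !mulX !addX !mulX mulrDl.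
  - by move=> b c; apply: alghom_int_ext => //; rewrite addX !lX.
  - by move=> b c; apply: alghom_int_ext => //; rewrite mulX !lX.
split=> [||a]; apply: poly_ext.
- rewrite -[LHS]/(da X) -[RHS]/(tsquare_map _ (poly_coadd D 'X)).
  by rewrite daX pevalX ahD copair_inl copair_inr.
- rewrite -[LHS]/(dm X) -[RHS]/(tsquare_map _ (poly_comul D 'X)).
  by rewrite dmX pevalX ahM copair_inl copair_inr.
- by rewrite /= lX hornerX.
Qed.

End Composite.

(** * Dual bases and polynomial compositeness *)

Section IntegralElements.
Context (D : idomainType).
Local Notation K := {fraction D}.

Lemma intgP (x : K) : intg x <-> exists a : D, x = a%:F.
Proof. by split=> [[a _ <-]|[a ->]]; exists a. Qed.

Lemma intg_frac (a : D) : intg a%:F.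
Proof. by exists a. Qed.

Lemma intg0 : intg (0 : K).
Proof. by rewrite -tofrac0; exact: intg_frac. Qed.

Lemma intgD (x y : K) : intg x -> intg y -> intg (x + y).
Proof. by move=> [a _ <-] [b _ <-]; rewrite -tofracD; exact: intg_frac. Qed.

Lemma intgB (x y : K) : intg x -> intg y -> intg (x - y).
Proof. by move=> [a _ <-] [b _ <-]; rewrite -tofracB; exact: intg_frac. Qed.

Lemma intgM (x y : K) : intg x -> intg y -> intg (x * y).
Proof. by move=> [a _ <-] [b _ <-]; rewrite -tofracM; exact: intg_frac. Qed.

Lemma intg_sum I (r : seq I) (P : pred I) (F : I -> K) :
  (forall i, P i -> intg (F i)) -> intg (\sum_(i <- r | P i) F i).
Proof.
by move=> intF; elim/big_rec: _ => [|i x Pi]; [exact: intg0 | exact/intgD/intF].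
Qed.

Lemma intg_eval (f : Int D) (a : D) : intg (val f).[a%:F].
Proof. by have /int_valuedP /(_ a) /intgP := valP f. Qed.

(** For [s = 1], the elements [e k] and functionals [phi k] form a dual basis
    of the module of integer-valued polynomials of degree less than [N], which
    is thus projective. *)
Definition dual_basis (N : nat) (s : D) : Prop :=
  exists (T : finType) (e : T -> Int D) (phi : T -> {scalar {poly K}}),
    (forall k (f : Int D), (size f <= N)%N -> intg (phi k (val f))) /\
    (forall f : {poly K}, (size f <= N)%N ->
       s%:F *: f = \sum_k phi k f *: val (e k)).

End IntegralElements.

(** * Functionals applied to polynomials in several variables *)

Section MixedEvaluation.
Context (D : idomainType) (X : choiceType) (d : {fset X}).
Local Notation K := {fraction D}.
Local Notation KX := {malg K[{cmonom X}]}.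

(** The tensor product of the functionals [psi x]. *)
Definition tensor_eval (psi : d -> {scalar {poly K}}) (F : KX) : K :=
  mmap idfun (fun m : {cmonom X} => \prod_(x : d) psi x 'X^(m (val x))) F.

Lemma tensor_evalD psi : {morph tensor_eval psi : F G / F + G}.
Proof. by move=> F G; exact: raddfD. Qed.

Lemma tensor_eval0 psi : tensor_eval psi 0 = 0.
Proof. exact: raddf0. Qed.

Lemma tensor_evalZ psi c F : tensor_eval psi (c *: F) = c * tensor_eval psi F.
Proof.
rewrite /tensor_eval (mmapEw (@msuppZ_le _ _ c F)) mulr_sumr.
by apply: eq_bigr => m _; rewrite mcoeffZ mulrA.
Qed.

Lemma tensor_eval_sum psi I (r : seq I) (P : pred I) (F : I -> KX) :
  tensor_eval psi (\sum_(i <- r | P i) F i) =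
  \sum_(i <- r | P i) tensor_eval psi (F i).
Proof. exact: (big_morph _ (tensor_evalD psi) (tensor_eval0 psi)). Qed.

Lemma tensor_eval_monom psi (m : {cmonom X}) :
  tensor_eval psi << m >> = \prod_(x : d) psi x 'X^(m (val x)).
Proof. by rewrite /tensor_eval mmapU mul1r. Qed.

Lemma subst_varZ (x : X) c (f : {poly K}) :
  subst_var x (c *: f) = c *: subst_var x f.
Proof.
by rewrite /subst_var -mul_polyC rmorphM /= map_polyC hornerM hornerC mul_malgC.
Qed.

Lemma subst_var_sum (x : X) I (r : seq I) (P : pred I) (F : I -> {poly K}) :
  subst_var x (\sum_(i <- r | P i) F i) = \sum_(i <- r | P i) subst_var x (F i).
Proof.
apply: (big_morph (subst_var x)) => [f g|]; rewrite /subst_var.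
  by rewrite rmorphD hornerD.
by rewrite rmorph0 horner0.
Qed.

Lemma malg_monomM (m n : {cmonom X}) : << m >> * << n >> = << mmul m n >> :> KX.
Proof. by rewrite -[LHS]/(fgmul _ _) fgmulUU mulr1. Qed.

Lemma malg_scale_monom c (m : {cmonom X}) : << c *g m >> = c *: << m >> :> KX.
Proof.
by rewrite -mul_malgC -[RHS]/(fgmul _ _) fgmulUU mulr1 mul1m.
Qed.

Lemma subst_var_Xn (x : X) n :
  exists m : {cmonom X}, subst_var x 'X^n = << m >> :> KX /\
    forall y, m y = (n * (x == y))%N.
Proof.
elim: n => [|n [m [mE m_y]]].
  exists (@mone {cmonom X}); split=> [|y]; last by rewrite cm1.
  by rewrite /subst_var map_polyXn hornerXn.
exists (mmul (ucm x) m); split=> [|y]; last by rewrite cmM cmU m_y mulSn.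
rewrite -[RHS]malg_monomM -mE /subst_var !map_polyXn !hornerXn.
exact: exprS.
Qed.

Lemma prod_subst_var_Xn (J : d -> nat) :
  exists m : {cmonom X}, \prod_(x : d) subst_var (val x) 'X^(J x) = << m >> :> KX /\
    forall y, m y = (\sum_(x : d) J x * (val x == y))%N.
Proof.
elim: (index_enum d) => [|x r [m [mE m_y]]].
  by exists (@mone {cmonom X}); rewrite big_nil; split=> // y; rewrite cm1 big_nil.
have [n [nE n_y]] := subst_var_Xn (val x) (J x).
exists (mmul n m); split=> [|y]; last by rewrite big_cons cmM n_y m_y.
by rewrite big_cons nE mE; exact: malg_monomM.
Qed.

Lemma malg_monom_in (m : {cmonom X}) : (finsupp m `<=` d)%fset ->
  << m >> = \prod_(x : d) subst_var (val x) 'X^(m (val x)) :> KX.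
Proof.
move=> md; have [m' [-> m'_y]] := prod_subst_var_Xn (fun x : d => m (val x)).
congr (<< _ >>); apply/eqP/cmP => y; rewrite m'_y.
have [yd|yd] := boolP (y \in d).
  rewrite (bigD1 [` yd]%fset) //= eqxx muln1 big1 ?addn0 // => x xy.
  by rewrite -[y]/(val [` yd]%fset) val_eqE (negbTE xy) muln0.
rewrite big1 => [|x _]; last first.
  by have [xy|] := eqVneq (val x) y; [rewrite -xy (valP x) in yd|rewrite muln0].
by apply/eqP; rewrite cmE_eq0; apply: contra yd; exact: fsubsetP.
Qed.

(** By multilinearity, expanding every [g x] in powers turns both sides into the same sum over
    families of exponents. *)
Lemma tensor_eval_prod psi (g : d -> {poly K}) :
  tensor_eval psi (\prod_(x : d) subst_var (val x) (g x)) =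
  \prod_(x : d) psi x (g x).
Proof.
pose N := (\max_(x : d) size (g x))%N.
have gE x : g x = \sum_(j < N) (g x)`_j *: 'X^j.
  rewrite -[LHS]coefK poly_def (big_ord_widen N (fun j => (g x)`_j *: 'X^j)); last first.
    exact: (leq_bigmax (F := fun x => size (g x))).
  rewrite big_mkcond; apply: eq_bigr => j _; case: ltnP => // /leq_sizeP.
  by move=> /(_ j (leqnn j)) ->; rewrite scale0r.
under eq_bigr => x _ do [rewrite gE subst_var_sum;
  under eq_bigr => j _ do rewrite subst_varZ].
under [RHS]eq_bigr => x _ do [rewrite gE linear_sum;
  under eq_bigr => j _ do rewrite linearZ /=].
rewrite !bigA_distr_bigA tensor_eval_sum; apply: eq_bigr => J _.
rewrite scaler_prod tensor_evalZ big_split /=; congr (_ * _).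
have [m [-> m_y]] := prod_subst_var_Xn (fun x : d => J x).
rewrite tensor_eval_monom; apply: eq_bigr => x _; congr (psi x 'X^_).
rewrite m_y (bigD1 x) //= eqxx muln1 big1 ?addn0 // => y yx.
by rewrite val_eqE (negbTE yx) muln0.
Qed.

Definition degrees_lt (N : nat) (F : KX) : Prop :=
  forall m, m \in msupp F -> (finsupp m `<=` d)%fset /\ forall x, (m x < N)%N.

(** If every [psi x] is an evaluation, this is a value of [F]. Evaluations are then traded for
    general functionals one variable at a time; [r] lists the variables already freed. *)
Lemma tensor_eval_intg (N : nat) (psi : d -> {scalar {poly K}}) (F : KX) :
  degrees_lt N F -> F \in @intX_valued D X ->
  (forall x (f : Int D), (size f <= N)%N -> intg (psi x (val f))) ->
  intg (tensor_eval psi F).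
Proof.
move=> dF /intX_valuedP intF.
pose is_eval (f : {scalar {poly K}}) := exists a : D, f =1 horner_eval a%:F.
suff main : forall (r : seq d) (psi : d -> {scalar {poly K}}),
    (forall x (f : Int D), (size f <= N)%N -> intg (psi x (val f))) ->
    (forall x, x \notin r -> is_eval (psi x)) -> intg (tensor_eval psi F).
  by move=> int_psi; apply: (main (enum {: d})) => // x; rewrite mem_enum.
elim=> [|y r IHr] {}psi int_psi ev_psi.
  have /choice [a aP] : forall x, is_eval (psi x) by move=> x; exact: ev_psi.
  (* The default 0 outside [d] is harmless, since the monomials of [F] only involve variables of
     [d]. *)
  pose a' (x : X) := oapp a 0 (insub x).
  have [b Fb] := intF a'; apply/intgP; exists b; rewrite -Fb /meval /tensor_eval /mmap.
  rewrite big_seq [RHS]big_seq; apply: eq_bigr => m /dF[md _]; congr (_ * _).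
  rewrite (cmevalEw _ md) [RHS](big_seq_fsetE _ _ predT
    (fun x => (a' x)%:F ^+ m x)) /=.
  apply: eq_bigr => x _.
  by rewrite aP /horner_eval hornerXn /a' valK.
(* [g] is [F] with every functional applied except the one at [y]. Its values are integral by
   induction, so [psi y] may be applied to it. *)
pose g : {poly K} := \sum_(m <- msupp F)
  (F@_m * \prod_(x : d | x != y) psi x 'X^(m (val x))) *: 'X^(m (val y)).
have psi_g (f : {scalar {poly K}}) :
    tensor_eval (fun x => if x == y then f else psi x) F = f g.
  rewrite linear_sum /tensor_eval /mmap; apply: eq_bigr => m _.
  rewrite linearZ /= -mulrA; congr (_ * _); rewrite (bigD1 y) //= eqxx mulrC.
  by congr (_ * _); apply: eq_bigr => x /negbTE ->.
have gN : (size g <= N)%N.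
  rewrite /g big_seq; apply: (leq_trans (size_sum _ _ _)); apply/bigmax_leqP_seq.
  move=> m _ /dF [_ mN]; apply: (leq_trans (size_scale_leq _ _)).
  by rewrite size_polyXn.
have int_g : g \in @int_valued D.
  apply/int_valuedP => a; apply/intgP.
  rewrite -[g.[_]]/(horner_eval a%:F g) -psi_g.
  apply: IHr => [x f fN|x xr]; case: eqP => [_|/eqP xy].
  - exact: intg_eval.
  - exact: int_psi.
  - by exists a.
  - by apply: ev_psi; rewrite inE (negbTE xy).
have -> : tensor_eval psi F = psi y g.
  rewrite -psi_g; congr (tensor_eval _ _); apply: funext => x.
  by case: eqP => [->|].
exact: (int_psi y (MkInt int_g)).
Qed.

End MixedEvaluation.

(** * Bijectivity of [theta] from dual bases *)

Section DualBasisComposite.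
Context (D : idomainType).
Local Notation K := {fraction D}.
Hypothesis has_dual_basis : forall N, @dual_basis D N 1.
Context (X : choiceType).
Local Notation KX := {malg K[{cmonom X}]}.
Local Notation T := (tensor (fun _ : X => Int D)).
Local Notation inj x := (tinj (fun _ : X => Int D) x).

Lemma tensor_span (t : T) : exists L : seq (D * seq (X * Int D)),
  t = \sum_(l <- L) algmap T l.1 * \prod_(p <- l.2) inj p.1 p.2.
Proof.
rewrite -(tclass_repr t); elim: (repr t) => [a|x s|u [L LE] v [M ME]|u [L LE] v [M ME]].
- by exists [:: (a, [::])]; rewrite big_seq1 big_nil mulr1.
- by exists [:: (1, [:: (x, s)])]; rewrite !big_seq1 rmorph1 mul1r.
- by exists (L ++ M); rewrite big_cat tclassD LE ME.
exists [seq (l.1 * m.1, l.2 ++ m.2) | l <- L, m <- M].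
have -> : tclass (TMul u v) = tclass u * tclass v :> T by exact: tclassM.
rewrite LE ME big_allpairs_dep mulr_suml.
apply: eq_bigr => l _; rewrite mulr_sumr; apply: eq_bigr => m _.
by rewrite rmorphM big_cat mulrACA.
Qed.

(** Factors sharing a variable are merged, and absent variables get the factor 1, so that each
    variable of [d] can be expanded once. *)
Lemma prod_tinj (d : {fset X}) (l : seq (X * Int D)) :
  (forall p, p \in l -> p.1 \in d) ->
  \prod_(p <- l) inj p.1 p.2 =
  \prod_(x : d) inj (val x) (\prod_(p <- l | p.1 == val x) p.2).
Proof.
elim: l => [|p l IHl] ld.
  by rewrite big_nil big1 // => x _; rewrite big_nil ah1.
have pd : p.1 \in d by apply: ld; rewrite mem_head.
rewrite big_cons IHl; last by move=> q ql; apply: ld; rewrite inE ql orbT.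
rewrite (bigD1 [` pd]%fset) // [RHS](bigD1 [` pd]%fset) // big_cons eqxx.
rewrite ahM mulrA; congr (_ * _); apply: eq_bigr => x xp.
rewrite big_cons; case: eqP => // px; case/eqP: xp.
exact/val_inj/esym.
Qed.

Section Expansion.
Context (d : {fset X}) (N : nat) (I : finType) (e : I -> Int D).
Context (phi : I -> {scalar {poly K}}).
Hypothesis int_phi : forall k (f : Int D), (size f <= N)%N -> intg (phi k (val f)).
Hypothesis phi_e : forall f : {poly K}, (size f <= N)%N ->
  1%:F *: f = \sum_k phi k f *: val (e k).

Local Notation phis h := (fun x : d => phi (h x)).

(** The coefficients depend on [t] only through [theta t]; hence such a [t] vanishes as soon as
    [theta t] does. *)
Definition expands (t : T) : Prop := exists c : {ffun d -> I} -> D,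
  t = \sum_(h : {ffun d -> I}) algmap T (c h) * \prod_(x : d) inj (val x) (e (h x)) /\
  forall h, (c h)%:F = tensor_eval (phis h) (val (theta D X t)).

Lemma expands0 : expands 0.
Proof.
exists (fun=> 0); split=> [|h]; last by rewrite ah0 tensor_eval0 tofrac0.
by rewrite big1 // => h _; rewrite rmorph0 mul0r.
Qed.

Lemma expandsD t u : expands t -> expands u -> expands (t + u).
Proof.
move=> [b [tE tb]] [c [uE uc]]; exists (fun h => b h + c h); split=> [|h].
  by rewrite {1}tE {1}uE -big_split; apply: eq_bigr => h _; rewrite rmorphD mulrDl.
by rewrite ahD tofracD tb uc /= tensor_evalD.
Qed.

Lemma expandsZ a t : expands t -> expands (algmap T a * t).
Proof.
move=> [c [tE tc]]; exists (fun h => a * c h); split=> [|h].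
  by rewrite {1}tE mulr_sumr; apply: eq_bigr => h _; rewrite rmorphM mulrA.
by rewrite ahM ah_alg tofracM tc /= mul_malgC tensor_evalZ.
Qed.

Lemma theta_prod (g : d -> Int D) :
  val (theta D X (\prod_(x : d) inj (val x) (g x))) =
  \prod_(x : d) subst_var (val x) (val (g x)).
Proof.
rewrite !rmorph_prod; apply: eq_bigr => x _.
rewrite -[RHS]/(val (int_subst D (val x) (g x))); congr (val _).
exact: (tlift_tinj (@int_subst D X)).
Qed.

(** The coordinates of each factor along [e] lie in [D], so the product can be distributed inside
    the tensor product over [D]. *)
Lemma expands_prod (g : d -> Int D) : (forall x, size (g x) <= N)%N ->
  expands (\prod_(x : d) inj (val x) (g x)).
Proof.
move=> gN.
have /choice [b bE] : forall p : d * I, exists b : D, phi p.2 (val (g p.1)) = b%:F.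
  by move=> p; apply/intgP/int_phi/gN.
exists (fun h => \prod_(x : d) b (x, h x)); split=> [|h]; last first.
  rewrite theta_prod tensor_eval_prod rmorph_prod.
  by apply: eq_bigr => x _; exact/esym/(bE (x, h x)).
have gE x : g x = \sum_k algmap (Int D) (b (x, k)) * e k.
  apply: val_inj; rewrite rmorph_sum -[LHS]scale1r -tofrac1 phi_e; last exact: gN.
  by apply: eq_bigr => k _; rewrite rmorphM /= mul_polyC -(bE (x, k)).
have -> : \prod_(x : d) inj (val x) (g x) =
    \prod_(x : d) \sum_k algmap T (b (x, k)) * inj (val x) (e k).
  apply: eq_bigr => x _; rewrite [in LHS]gE rmorph_sum; apply: eq_bigr => k _.
  rewrite [LHS]ahM; congr (_ * _); exact: ah_alg.
rewrite bigA_distr_bigA; apply: eq_bigr => h _.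
by rewrite big_split rmorph_prod.
Qed.

Lemma malg_expansion (F : KX) : degrees_lt d N F ->
  F = \sum_(h : {ffun d -> I}) tensor_eval (phis h) F *:
        \prod_(x : d) subst_var (val x) (val (e (h x))).
Proof.
move=> dF.
have monomE m : m \in msupp F -> << m >> = \sum_(h : {ffun d -> I})
    (\prod_(x : d) phi (h x) 'X^(m (val x))) *:
      \prod_(x : d) subst_var (val x) (val (e (h x))) :> KX.
  move=> /dF [md mN]; rewrite (malg_monom_in D md).
  have XE x : subst_var x 'X^(m x) =
      \sum_k phi k 'X^(m x) *: subst_var x (val (e k)) :> KX.
    have := @phi_e 'X^(m x); rewrite size_polyXn tofrac1 scale1r => /(_ (mN x)).
    move/(congr1 (subst_var x)); rewrite subst_var_sum => ->.
    by apply: eq_bigr => k _; rewrite subst_varZ.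
  transitivity (\prod_(x : d) \sum_k phi k 'X^(m (val x)) *:
      subst_var (val x) (val (e k)) : KX); first by apply: eq_bigr => x _; exact: XE.
  by rewrite bigA_distr_bigA; apply: eq_bigr => h _; rewrite scaler_prod.
rewrite {1}(monalgE F); under [RHS]eq_bigr do rewrite scaler_suml.
rewrite exchange_big /= big_seq [RHS]big_seq; apply: eq_bigr => m /monomE mE.
rewrite malg_scale_monom mE scaler_sumr; apply: eq_bigr => h _; exact: scalerA.
Qed.

End Expansion.

Lemma theta_dual_basis_inj : injective (theta D X).
Proof.
suff theta0 (t : T) : theta D X t = 0 -> t = 0.
  move=> t u /eqP; rewrite -subr_eq0 -raddfB => /eqP /theta0 /eqP.
  by rewrite subr_eq0 => /eqP.
have [L LE] := tensor_span t.
pose d : {fset X} := seq_fset tt [seq p.1 | p <- flatten [seq l.2 | l <- L]].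
pose g (l : seq (X * Int D)) (x : d) := \prod_(p <- l | p.1 == val x) p.2.
pose N := (\max_(l <- L) \max_(x : d) size (g l.2 x))%N.
have [I [e [phi [int_phi phi_e]]]] := has_dual_basis N.
have [c [tE ct]] : expands d e phi t.
  suff main M : {subset M <= L} -> expands d e phi
      (\sum_(l <- M) algmap T l.1 * \prod_(p <- l.2) inj p.1 p.2).
    by rewrite LE; exact: main.
  elim: M => [|l M IHM] ML.
    by rewrite big_nil; exact: expands0.
  have lL : l \in L by apply: ML; rewrite mem_head.
  rewrite big_cons; apply: expandsD; last first.
    by apply: IHM => k kM; apply: ML; rewrite inE kM orbT.
  apply: expandsZ; rewrite (prod_tinj (d := d)) => [|p pl].
    apply: (expands_prod int_phi phi_e) => x.
    apply: leq_trans (leq_bigmax_seq _ lL isT).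
    exact: (leq_bigmax (F := fun x => size (g l.2 x))).
  rewrite seq_fsetE; apply/mapP; exists p => //; apply/flattenP.
  by exists l.2 => //; exact: map_f.
move=> t0; rewrite tE big1 // => h _; have := ct h.
rewrite t0 tensor_eval0 => /eqP; rewrite tofrac_eq0 => /eqP ->.
by rewrite rmorph0 mul0r.
Qed.

Lemma theta_dual_basis_surj (F : IntX D X) : exists t, theta D X t = F.
Proof.
pose d : {fset X} := 
  seq_fset tt (flatten [seq enum_fset (finsupp m) | m : {cmonom X} <- msupp (val F)]).
(* The successor turns a bound on the exponents into the strict one of [degrees_lt]. *)
pose N := (\max_(m <- msupp (val F)) \max_(x : d) (m : {cmonom X}) (val x)).+1.
have dF : degrees_lt d N (val F).
  move=> m mF; have md : (finsupp m `<=` d)%fset.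
    apply/fsubsetP => x xm; rewrite seq_fsetE; apply/flattenP.
    by exists (enum_fset (finsupp m)) => //; exact: map_f.
  split=> // x; have [xm|] := boolP (x \in finsupp m); last first.
    by rewrite -cmE_eq0 => /eqP ->.
  have xd := fsubsetP md x xm; rewrite ltnS.
  apply: leq_trans (leq_bigmax_seq _ mF isT).
  exact: (leq_bigmax (F := fun x : d => m (val x)) [` xd]%fset).
have [I [e [phi [int_phi phi_e]]]] := has_dual_basis N.
have /choice [c cE] : forall h : {ffun d -> I}, exists c : D,
    tensor_eval (fun x => phi (h x)) (val F) = c%:F.
  move=> h; apply/intgP/(tensor_eval_intg dF); first exact: valP.
  by move=> x f; exact: int_phi.
exists (\sum_(h : {ffun d -> I}) algmap T (c h) * \prod_(x : d) inj (val x) (e (h x))).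
apply: val_inj; rewrite !rmorph_sum [RHS](malg_expansion phi_e dF).
apply: eq_bigr => h _; rewrite -mul_malgC cE -theta_prod.
apply: (etrans (congr1 val (ahM (theta D X) _ _))); rewrite ah_alg.
exact: rmorphM.
Qed.

Lemma theta_dual_basis_bij : bijective (theta D X).
Proof.
have [g gK] := choice theta_dual_basis_surj.
by exists g => // t; apply: theta_dual_basis_inj; exact: gK.
Qed.

End DualBasisComposite.

Lemma dual_basis_composite (D : idomainType) :
  (forall N, @dual_basis D N 1) -> polynomially_composite D.
Proof. by move=> dbD X; exact: theta_dual_basis_bij. Qed.

(** * Existence of dual bases *)

Section Ideals.
Context (D : idomainType).
Local Open Scope classical_set_scope.

Record ideal (J : set D) : Prop := Ideal {
  ideal0 : J 0;
  idealD : forall x y, J x -> J y -> J (x + y);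
  idealM : forall a x, J x -> J (a * x) }.

(** Maximality is expressed by [D/M] being a field. *)
Record maximal_ideal (M : set D) : Prop := MaximalIdeal {
  maximal_is_ideal : ideal M;
  maximal_proper : ~ M 1;
  maximal_inv : forall a, ~ M a -> exists b, M (1 - b * a) }.

Lemma maximal_ideal_exists (J : set D) : ideal J -> ~ J 1 ->
  exists2 M, maximal_ideal M & J `<=` M.
Proof.
move=> idJ J1; pose P (A : set D) := A = set0 \/ [/\ ideal A, J `<=` A & ~ A 1].
have PJ : P J by right; split.
have [|A [PA maxA]] := @Zorn_bigcup _ P.
  move=> F FP totF.
  have [[A0 FA0 A0n0]|allF0] := pselect (exists2 A, F A & A !=set0); last first.
    left; rewrite -subset0 => x [A FA Ax].
    by case: allF0; exists A => //; exists x.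
  have FP' A x : F A -> A x -> [/\ ideal A, J `<=` A & ~ A 1].
    by move=> /FP [->|].
  have [x0 A0x0] := A0n0; have [id0 JA0 _] := FP' _ _ FA0 A0x0.
  right; split.
  - split.
    + by exists A0 => //; exact: ideal0.
    + move=> x y [A FA Ax] [B FB By].
      have [idA _ _] := FP' _ _ FA Ax; have [idB _ _] := FP' _ _ FB By.
      have [AB|BA] := totF _ _ FA FB.
        by exists B => //; apply: idealD => //; exact: AB.
      by exists A => //; apply: idealD => //; exact: BA.
    + move=> a x [A FA Ax]; exists A => //.
      by have [idA _ _] := FP' _ _ FA Ax; exact: idealM.
  - by move=> x /JA0 A0x; exists A0.
  - by move=> [A FA A1]; have [_ _ /(_ A1)] := FP' _ _ FA A1.
case: PA => [A0|[idA JA A1]].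
  have : A `<` J by rewrite A0; split=> // /(_ 0 (ideal0 idJ)).
  by move=> /maxA.
exists A => //; split=> // a Aa; apply: contrapT => noinv.
(* The ideal generated by [A] and [a] is proper: [1 = y + c a] would invert [a] modulo [A]. *)
pose B : set D := [set x | exists y c, A y /\ x = y + c * a].
have AB : A `<` B.
  split=> [x Ax|]; first by exists x, 0; rewrite mul0r addr0.
  by move=> BA; apply/Aa/BA; exists 0, 1; rewrite mul1r add0r; split=> //; exact: ideal0.
apply: (maxA _ AB); right; split.
- split; first by exists 0, 0; rewrite mul0r addr0; split=> //; exact: ideal0.
    move=> _ _ [y [c [Ay ->]]] [z [e [Az ->]]]; exists (y + z), (c + e).
    by rewrite mulrDl addrACA; split=> //; exact: idealD.
  move=> b _ [y [c [Ay ->]]]; exists (b * y), (b * c).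
  by rewrite mulrDr mulrA; split=> //; exact: idealM.
- by move=> x Jx; apply: (properW AB); exact: JA.
- move=> [y [c [Ay yc]]]; apply: noinv; exists c.
  by rewrite yc addrK.
Qed.

Section Maximal.
Context (M : set D) (maxM : maximal_ideal M).
Let idM := maximal_is_ideal maxM.

Lemma maximal_prime x y : ~ M x -> ~ M y -> ~ M (x * y).
Proof.
move=> Mx My Mxy; have [b Mb] := maximal_inv maxM Mx; apply: My.
have -> : y = y * (1 - b * x) + b * (x * y).
  by rewrite mulrBr mulr1 mulrCA [y * x]mulrC subrK.
by apply: idealD => //; exact: idealM.
Qed.

Lemma maximal_primeX x n : ~ M x -> ~ M (x ^+ n).
Proof.
move=> Mx; elim: n => [|n IHn]; first exact: maximal_proper.
by rewrite exprS; exact: maximal_prime.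
Qed.

Lemma maximal_sub1 x : M x -> ~ M (1 - x).
Proof.
by move=> Mx M1; apply: (maximal_proper maxM); rewrite -(subrK x 1); exact: idealD.
Qed.

Lemma idealX x n : M x -> (0 < n)%N -> M (x ^+ n).
Proof. by case: n => // n Mx _; rewrite exprSr; exact: idealM. Qed.

End Maximal.
End Ideals.

Lemma cancel_frac (F : fieldType) (x y z t : F) :
  t != 0 -> x * y * z = x * t * z * (y / t).
Proof. by move=> t0; field. Qed.

Section LocalDualBasis.
Context (D : idomainType).
Local Notation K := {fraction D}.

Lemma dual_basisI N (s : D) (T : finType) (e : T -> Int D)
    (phi : T -> {poly K} -> K) : (forall k, scalar (phi k)) ->
  (forall k (f : Int D), (size f <= N)%N -> intg (phi k (val f))) ->
  (forall f : {poly K}, (size f <= N)%N ->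
     s%:F *: f = \sum_k phi k f *: val (e k)) ->
  dual_basis N s.
Proof.
move=> lin_phi int_phi phi_e.
pose phi' k : {scalar {poly K}} :=
  HB.pack (phi k) (GRing.isLinear.Build K {poly K} K _ (phi k) (lin_phi k)).
by exists T, e, phi'.
Qed.

(** For a sum the two families are put side by side; for a multiple the [e k] are scaled. *)
Lemma dual_basis_ideal N : ideal (@dual_basis D N).
Proof.
split.
- apply: (@dual_basisI _ _ void (fun=> 0) (fun _ _ => 0)) => [[]|[]|f _].
  by rewrite tofrac0 scale0r big_pred0.
- move=> s t [S [e [phi [int_phi phi_e]]]] [T [f [psi [int_psi psi_f]]]].
  exists (S + T)%type, (fun k => match k with inl i => e i | inr j => f j end).
  exists (fun k => match k with inl i => phi i | inr j => psi j end).
  split=> [[i|j]|h hN]; [exact: int_phi|exact: int_psi|].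
  by rewrite tofracD scalerDl phi_e // psi_f // big_sumType.
- move=> a s [S [e [phi [int_phi phi_e]]]].
  exists S, (fun k => algmap (Int D) a * e k), phi; split=> // h hN.
  rewrite tofracM -scalerA phi_e // scaler_sumr; apply: eq_bigr => k _.
  by rewrite rmorphM /= mul_polyC !scalerA mulrC.
Qed.

Definition denominators (N : nat) (s : D) : Prop :=
  forall (f : Int D) i, (size f <= N)%N -> intg (s%:F * (val f)`_i).

Lemma denominators_dual_basis N s : denominators N s -> dual_basis N s.
Proof.
move=> den_s; apply: (@dual_basisI _ _ 'I_N (fun j => int_incl D 'X^j)
  (fun (j : 'I_N) f => s%:F * f`_j)) => [j c f g|j f fN|f fN].
- by rewrite coefD coefZ mulrDr mulrCA.
- exact: den_s.
rewrite -[f in LHS]coefK poly_def (big_ord_widen N (fun i => f`_i *: 'X^i)) //.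
rewrite big_mkcond scaler_sumr; apply: eq_bigr => j _ /=.
rewrite map_polyXn -scalerA; case: ltnP => // /leq_sizeP /(_ j (leqnn j)) ->.
by rewrite scale0r.
Qed.

(** Cramer's rule: the coefficients of [f] times the Vandermonde matrix are values of [f], hence in
    [D], and so are the entries of the adjugate. *)
Lemma denominators_Vandermonde N (a : 'rV[D]_N) :
  denominators N (\det (Vandermonde N a)).
Proof.
move=> f i fN; have [iN|iN] := ltnP i N; last first.
  by rewrite nth_default ?(leq_trans fN) // mulr0; exact: intg0.
pose A := map_mx (@tofrac D) (Vandermonde N a).
pose c : 'rV[K]_N := \row_j (val f)`_j.
have cA j : (c *m A) 0 j = (val f).[(a 0 j)%:F].
  rewrite (horner_coef_wide _ fN) mxE; apply: eq_bigr => k _.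
  by rewrite !mxE tofracXn.
have : (\det A *: c) 0 (Ordinal iN) = ((c *m A) *m \adj A) 0 (Ordinal iN).
  by rewrite -mulmxA mul_mx_adj mul_mx_scalar.
rewrite !mxE det_map_mx => ->; apply: intg_sum => j _; apply: intgM.
  by rewrite cA; exact: intg_eval.
by rewrite -map_mx_adj mxE; exact: intg_frac.
Qed.

(** At the powers of [x] the factors of the determinant are [x^j - x^i = -(1 - x^(j-i)) x^i] with
    [i < j], and [1 - x^(j-i)] is outside [M]. *)
Lemma denominators_power N (M : set D) (x : D) : maximal_ideal M -> M x ->
  exists n s, ~ M s /\ denominators N (s * x ^+ n).
Proof.
move=> maxM Mx; pose P (y : D) := exists n s, ~ M s /\ y = s * x ^+ n.
have P1 : P 1.
  by exists 0, 1; rewrite mulr1; split=> //; exact: maximal_proper maxM.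
have PM y z : P y -> P z -> P (y * z).
  move=> [m [s [Ms ->]]] [n [t [Mt ->]]]; exists (m + n)%N, (s * t).
  by rewrite exprD mulrACA; split=> //; exact: maximal_prime.
suff [n [s [Ms E]]] : P (\det (Vandermonde N (\row_(j < N) x ^+ j))).
  by exists n, s; rewrite -E; split=> //; exact: denominators_Vandermonde.
rewrite det_Vandermonde; apply: (big_ind P) => // i _.
apply: (big_ind P) => // j ij; rewrite !mxE.
exists i, (- (1 - x ^+ (j - i))); split.
  rewrite -mulN1r; apply: (maximal_prime maxM) => [M1|].
    apply: (maximal_proper maxM); rewrite -[1]opprK -mulN1r.
    exact: (idealM (maximal_is_ideal maxM)).
  by apply: (maximal_sub1 maxM); apply: (idealX maxM) => //; rewrite subn_gt0.
by rewrite opprB mulrBl mul1r -exprD subnK // ltnW.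
Qed.

(** * Orderings at a maximal ideal locally generated by [p] *)

Section Uniformizer.
Context (M : set D) (maxM : maximal_ideal M) (p u : D).
Hypothesis p0 : p != 0.
Hypothesis Mp : M p.
Hypothesis Mu : ~ M u.
Hypothesis uniformP : forall x, M x -> exists y, u * x = p * y.
Let idM := maximal_is_ideal maxM.

(** [val_ge k x] says that the value of [x] in the localization at [M], whose
    maximal ideal is generated by [p], is at least [k], and [val_eq k x] that
    it is [k]. *)
Definition val_ge (k : nat) (x : D) : Prop :=
  exists y, u ^+ k * x = p ^+ k * y.

Definition val_eq (k : nat) (x : D) : Prop :=
  exists2 y, ~ M y & u ^+ k * x = p ^+ k * y.

Lemma val_eq_nge k x : val_eq k x -> ~ val_ge k.+1 x.
Proof.
move=> [y My uy] [z]; rewrite exprS -mulrA uy => uz.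
have {}uz : u * y = p * z.
  by apply: (mulfI (expf_neq0 k p0)); rewrite mulrCA uz exprS; ring.
by apply: (maximal_prime maxM Mu My); rewrite uz mulrC; exact: idealM.
Qed.

Lemma val_nge_eq k x : ~ val_ge k x -> exists2 j, (j < k)%N & val_eq j x.
Proof.
elim: k => [|k IHk] nge; first by case: nge; exists x; rewrite !expr0 !mul1r.
have [[y uy]|/IHk [j jk vj]] := pselect (val_ge k x); last first.
  by exists j => //; exact: ltnW.
exists k => //; exists y => // My; apply: nge; have [z uz] := uniformP My.
by exists z; rewrite exprS -mulrA uy mulrCA uz mulrA -exprSr.
Qed.

Lemma val_eqM j k x y : val_eq j x -> val_eq k y -> val_eq (j + k) (x * y).
Proof.
move=> [x' Mx ux] [y' My uy]; exists (x' * y'); first exact: maximal_prime.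
by rewrite !exprD mulrACA ux uy mulrACA.
Qed.

Lemma val_geB k x y : val_ge k x -> val_ge k y -> val_ge k (x - y).
Proof.
by move=> [x' ux] [y' uy]; exists (x' - y'); rewrite mulrBr ux uy -mulrBr.
Qed.

(** The value of [p^i - a] may be infinite, but for a given [a] this happens for at most one [i]:
    the difference of two such elements is [p^i0 - p^i], of value exactly [i0] when [i0 < i]. *)
Lemma far_point (l : seq D) :
  exists B : nat, forall i a, (B <= i)%N -> a \in l ->
    exists k, val_eq k (p ^+ i - a).
Proof.
elim: l => [|a l [B BP]]; first by exists 0.
have [[i0 far]|near] := pselect (exists i, ~ exists k, val_eq k (p ^+ i - a));
    last first.
  exists B => i b Bi; rewrite inE => /predU1P[->|/BP]; last exact.
  by apply: contrapT => far; apply: near; exists i.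
exists (maxn B i0.+1) => i b; rewrite geq_max => /andP[Bi i0i].
rewrite inE => /predU1P[->|]; last exact: BP.
apply: contrapT => far'.
have all_ge j : (~ exists k, val_eq k (p ^+ j - a)) -> val_ge i0.+1 (p ^+ j - a).
  move=> nov; apply: contrapT => /val_nge_eq [k _ vk]; apply: nov; by exists k.
have := val_geB (all_ge _ far) (all_ge _ far').
rewrite opprB addrA subrK; apply: val_eq_nge.
exists (u ^+ i0 * (1 - p ^+ (i - i0))).
  apply: maximal_prime => //; first exact: maximal_primeX.
  by apply: maximal_sub1 => //; apply: idealX => //; rewrite subn_gt0.
have -> : p ^+ i = p ^+ i0 * p ^+ (i - i0) by rewrite -exprD subnKC // ltnW.
ring.
Qed.

(** The point [a] minimizes the value of the product; [far_point] ensures that some value is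
    finite. *)
Lemma next_point (l : seq D) : exists w a,
  (forall d, val_ge w (\prod_(b <- l) (d - b))) /\ val_eq w (\prod_(b <- l) (a - b)).
Proof.
pose P w := `[< exists a, val_eq w (\prod_(b <- l) (a - b)) >].
have exP : exists w, P w.
  have [B BP] := far_point l.
  suff [w vw] : exists w, val_eq w (\prod_(b <- l) (p ^+ B - b)).
    by exists w; apply/asboolP; exists (p ^+ B).
  rewrite big_seq; apply: (big_ind (fun x => exists w, val_eq w x)).
  - by exists 0, 1; [exact: maximal_proper maxM | rewrite !expr0].
  - by move=> x y [j vj] [k vk]; exists (j + k)%N; exact: val_eqM.
  - by move=> b; exact: BP.
have [w /asboolP [a va] minw] := ex_minnP exP.
exists w, a; split=> // d; apply: contrapT => /val_nge_eq [j jw vj].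
have /minw : P j by apply/asboolP; exists d.
by rewrite leqNgt jw.
Qed.

(** A [p]-ordering in the sense of Bhargava. *)
Lemma p_ordering N : exists (a : nat -> D) (w : nat -> nat), forall n, (n < N)%N ->
  (forall d, val_ge (w n) (\prod_(i < n) (d - a i))) /\
  val_eq (w n) (\prod_(i < n) (a n - a i)).
Proof.
elim: N => [|N [a [w aw]]]; first by exists (fun=> 0), (fun=> 0%N).
have [w' [a' [ge_w' eq_w']]] := next_point [seq a i | i <- iota 0 N].
exists (fun n => if n == N then a' else a n).
exists (fun n => if n == N then w' else w n).
have prodE n d : (n <= N)%N ->
    \prod_(i < n) (d - (if i == N :> nat then a' else a i)) =
    \prod_(i < n) (d - a i).
  move=> nN; apply: eq_bigr => i _; case: eqP => // iN.
  by have := leq_trans (ltn_ord i) nN; rewrite iN ltnn.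
have listE d : \prod_(b <- [seq a i | i <- iota 0 N]) (d - b) =
    \prod_(i < N) (d - a i).
  by rewrite big_map -{1}[N]subn0 big_mkord.
move=> n; rewrite ltnS leq_eqVlt => /predU1P[->|nN].
  rewrite eqxx; split=> [d|]; first by rewrite prodE // -listE.
  by rewrite prodE // -listE.
have [ge_w eq_w] := aw n nN; rewrite (ltn_eqF nN); split=> [d|];
  by rewrite prodE ?(ltnW nN).
Qed.

(** * Newton interpolation *)

Section Newton.
Context (a : nat -> D).

Definition newton_poly (n : nat) : {poly K} := \prod_(i < n) ('X - ((a i)%:F)%:P).

(** This is the divided difference of [f] at [a 0, ..., a n]. Euclidean division makes it linear in
    [f] and avoids dividing by differences of points. *)
Definition divided_diff (n : nat) (f : {poly K}) : K :=
  (f %/ newton_poly n).[(a n)%:F].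

Lemma divided_diff_scalar n : scalar (divided_diff n).
Proof.
by move=> c f g; rewrite /divided_diff divpD divpZl hornerD hornerZ.
Qed.

Lemma newton_poly_eval n d :
  (newton_poly n).[d%:F] = (\prod_(i < n) (d - a i))%:F.
Proof.
rewrite horner_prod rmorph_prod; apply: eq_bigr => i _.
by rewrite hornerXsubC -tofracB.
Qed.

Lemma size_newton_poly n : size (newton_poly n) = n.+1.
Proof. by rewrite size_prod_XsubC /index_enum -enumT size_enum_ord. Qed.

Lemma newton_polyS n :
  newton_poly n.+1 = newton_poly n * ('X - ((a n)%:F)%:P).
Proof. exact: big_ord_recr. Qed.

Lemma newton_interpolation n (f : {poly K}) :
  f = \sum_(m < n) divided_diff m f *: newton_poly m +
      f %/ newton_poly n * newton_poly n.
Proof.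
elim: n => [|n IHn]; first by rewrite big_ord0 add0r /newton_poly big_ord0 divp1 mulr1.
rewrite {1}IHn big_ord_recr /= -addrA; congr (_ + _).
rewrite newton_polyS -divp_divl.
rewrite /divided_diff; set g := f %/ _.
have gE := divp_eq g ('X - (a n)%:F%:P); rewrite modp_XsubC in gE.
by rewrite {1}gE -mul_polyC; ring.
Qed.

End Newton.

(** The basis is [newton_poly n] over [p^(w n)], integer-valued up to a power of [u] since the
    products have value at least [w n]. The functionals are scaled divided differences, integral up
    to a factor outside [M] since the value at [a n] is exactly [w n]. *)
Lemma uniformizer_dual_basis N : exists s, ~ M s /\ @dual_basis D N s.
Proof.
have [a [w aw]] := p_ordering N.
pose W := (\max_(n < N) w n)%N; pose U := u ^+ W.
have wW n : (n < N)%N -> (w n <= W)%N.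
  by move=> nN; exact: (leq_bigmax (F := fun n : 'I_N => w n) (Ordinal nN)).
have U_div n d : (n < N)%N ->
    exists z, U * \prod_(i < n) (d - a i) = p ^+ w n * z.
  move=> nN; have [/(_ d) [z uz] _] := aw n nN; exists (u ^+ (W - w n) * z).
  by rewrite /U -{1}(subnK (wW n nN)) exprD -mulrA uz mulrCA.
have U_eq n : (n < N)%N ->
    exists2 y, ~ M y & U * \prod_(i < n) (a n - a i) = p ^+ w n * y.
  move=> nN; have [_ [y My uy]] := aw n nN; exists (u ^+ (W - w n) * y).
    by apply: maximal_prime => //; exact: maximal_primeX.
  by rewrite /U -{1}(subnK (wW n nN)) exprD -mulrA uy mulrCA.
have [S MS int_dd] : exists2 S, ~ M S & forall m (f : Int D), (m < N)%N ->
    intg ((S * p ^+ w m)%:F * divided_diff a m (val f)).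
  suff: forall n, (n <= N)%N -> exists2 S, ~ M S & forall m (f : Int D),
      (m < n)%N -> intg ((S * p ^+ w m)%:F * divided_diff a m (val f)).
    exact.
  elim=> [|n IHn] nN; first by exists 1 => //; exact: maximal_proper maxM.
  have [S MS int_dd] := IHn (ltnW nN); have [y My Uy] := U_eq n nN.
  exists (S * y) => [|m f]; first exact: maximal_prime.
  rewrite ltnS leq_eqVlt => /predU1P[->|mn]; last first.
    have -> : S * y * p ^+ w m = y * (S * p ^+ w m) by ring.
    by rewrite tofracM -mulrA; apply: intgM; [exact: intg_frac | exact: int_dd].
  (* Evaluation at [a n] isolates the divided difference of index [n]; those of smaller index are
     handled by induction. *)
  have := congr1 (fun g : {poly K} => g.[(a n)%:F]) (newton_interpolation a n (val f)).
  rewrite hornerD horner_sum hornerM -/(divided_diff a n _) => fE.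
  have -> : (S * y * p ^+ w n)%:F * divided_diff a n (val f) = (S * U)%:F *
      (divided_diff a n (val f) * (newton_poly a n).[(a n)%:F]).
    rewrite newton_poly_eval mulrCA -tofracM -[S * U * _]mulrA Uy [RHS]mulrC.
    by congr (_%:F * _); ring.
  move: fE => /eqP; rewrite addrC -subr_eq => /eqP <-; rewrite mulrBr.
  apply: intgB; first by apply: intgM; [exact: intg_frac | exact: intg_eval].
  rewrite mulr_sumr; apply: intg_sum => k _; rewrite hornerZ newton_poly_eval.
  have [z Uz] := U_div k (a n) (ltn_trans (ltn_ord k) nN).
  rewrite mulrCA -tofracM -[S * U * _]mulrA Uz mulrC.
  have -> : S * (p ^+ w k * z) = z * (S * p ^+ w k) by ring.
  by rewrite tofracM -mulrA; apply: intgM; [exact: intg_frac | exact: int_dd].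
have pw0 n : (p ^+ w n)%:F != 0 by rewrite tofrac_eq0 expf_neq0.
have int_e (n : 'I_N) : (U%:F / (p ^+ w n)%:F) *: newton_poly a n \in @int_valued D.
  apply/int_valuedP => d; have [z Uz] := U_div n d (ltn_ord n); exists z.
  rewrite hornerZ newton_poly_eval mulrAC -tofracM Uz tofracM mulrAC mulfV ?mul1r //.
exists (S * U); split.
  by apply: maximal_prime => //; exact: maximal_primeX.
apply: (@dual_basisI _ _ 'I_N (fun n => MkInt (int_e n))
  (fun n f => (S * p ^+ w n)%:F * divided_diff a n f)) => [n c f g|n f fN|f fN].
- by rewrite divided_diff_scalar mulrDr mulrCA.
- exact: int_dd.
rewrite {1}(newton_interpolation a N f) divp_small ?size_newton_poly // mul0r addr0.
rewrite scaler_sumr; apply: eq_bigr => n _; rewrite !scalerA; congr (_ *: _).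
by rewrite !tofracM; exact/cancel_frac/pw0.
Qed.

End Uniformizer.

(** * Dual bases from properties of conductors *)

Section Conductors.

(** In terms of the conductors [E b = {x in D | x * b in D}], for [b] in [K]
    but not in [D]: an ideal is contained in one of them as soon as each of
    its finite subsets is. *)
Definition conductors_finitary : Prop := forall J : set D, ideal J ->
  (forall s : seq D, (forall x, x \in s -> J x) ->
     exists2 b : K, ~ intg b & forall x, x \in s -> intg (x%:F * b)) ->
  exists2 b : K, ~ intg b & forall x, J x -> intg (x%:F * b).

(** Multiplication by [b] does not preserve the conductor [E b]. *)
Definition conductors_unstable : Prop := forall b : K, ~ intg b ->
  exists2 m : D, intg (m%:F * b) & ~ intg (m%:F * b * b).

(** Elements are treated one at a time: if [n] is the least exponent with [x^n c b] in [D], it is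
    positive, and [c] is replaced by [x^(n-1) c]. This keeps what was achieved for the other
    elements. *)
Lemma power_conductor (b : K) (s : seq D) : ~ intg b ->
  (forall x, x \in s -> exists n, intg ((x ^+ n)%:F * b)) ->
  exists2 c : D, ~ intg (c%:F * b) & forall x, x \in s -> intg (x%:F * (c%:F * b)).
Proof.
move=> nb; elim: s => [|x s IHs] sb.
  by exists 1; rewrite ?tofrac1 ?mul1r.
have [y ys|c nc sc] := IHs; first by apply: sb; rewrite inE ys orbT.
have exn : exists n, `[< intg ((x ^+ n)%:F * (c%:F * b)) >].
  have [|n nb'] := sb x; first by rewrite mem_head.
  by exists n; apply/asboolP; rewrite mulrCA; apply: intgM nb'; exact: intg_frac.
have [[|n] /asboolP nP minn] := ex_minnP exn.
  by case: nc; rewrite expr0 tofrac1 mul1r in nP.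
exists (x ^+ n * c) => [xc|y].
  suff /minn : `[< intg ((x ^+ n)%:F * (c%:F * b)) >] by rewrite ltnn.
  by apply/asboolP; rewrite mulrA -tofracM.
rewrite inE => /predU1P[->|/sc yc].
  by rewrite tofracM -mulrA mulrA -tofracM -exprS.
by rewrite tofracM -mulrA mulrCA; apply: intgM yc; exact: intg_frac.
Qed.

Hypotheses (fin : conductors_finitary) (unst : conductors_unstable).

Lemma maximal_dual_basis N (M : set D) : maximal_ideal M ->
  exists2 s, ~ M s & @dual_basis D N s.
Proof.
move=> maxM; have idM := maximal_is_ideal maxM.
have [[s Ms dens]|denM] := pselect (exists2 s, ~ M s & denominators N s).
  by exists s => //; exact: denominators_dual_basis.
have [l Ml|b nb Mb] := fin idM.
  (* [t] is the product of the factors that [denominators_power] gives for the elements of [l]. *)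
  have [t Mt lt] : exists2 t, ~ M t &
      forall x, x \in l -> exists n, denominators N (t * x ^+ n).
    elim: l Ml => [|x l IHl] Ml; first by exists 1 => //; exact: maximal_proper maxM.
    have [y yl|t Mt lt] := IHl; first by apply: Ml; rewrite inE yl orbT.
    have [|n [s [Ms dens]]] := @denominators_power N M x maxM.
      by apply: Ml; rewrite mem_head.
    exists (t * s) => [|y]; first exact: maximal_prime.
    rewrite inE => /predU1P[->|/lt [k denk]].
      exists n => f i fN; rewrite -[t * s * _]mulrA tofracM -mulrA.
      by apply: intgM; [exact: intg_frac | exact: dens].
    exists k => f i fN; have -> : t * s * y ^+ k = s * (t * y ^+ k) by ring.
    rewrite tofracM -mulrA.
    by apply: intgM; [exact: intg_frac | exact: denk].
  (* As [t] is no common denominator, some [t f_i] is outside [D], while each [x] in [l] has a power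
     multiplying it into [D]. *)
  have [f [i [fN nf]]] : exists (f : Int D) i,
      (size f <= N)%N /\ ~ intg (t%:F * (val f)`_i).
    apply: contrapT => noden; apply: denM; exists t => // f i fN.
    by apply: contrapT => nf; apply: noden; exists f, i.
  have [x /lt [n dn]|c nc lc] := power_conductor (s := l) nf.
    by exists n; rewrite mulrA -tofracM [x ^+ n * t]mulrC; exact: dn.
  by exists (c%:F * (t%:F * (val f)`_i)).
(* [m] will be the local generator of [M]: with [u = m b], each [x] in [M] satisfies
   [u x = m (x b)]. *)
have [m /intgP [u mb] nmb] := unst nb.
have Mm : M m.
  apply: contrapT => /(maximal_inv maxM) [c Mc]; apply: nb.
  have -> : b = (1 - c * m)%:F * b + c%:F * (m%:F * b).
    by rewrite tofracB tofrac1 tofracM mulrBl mul1r mulrA subrK.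
  by apply: intgD; [exact: Mb | rewrite mb -tofracM; exact: intg_frac].
(* If [u] were in [M], then [u b = m b^2] would be in [D]. *)
have Mu : ~ M u by move=> /Mb; rewrite -mb.
have m0 : m != 0.
  apply/eqP => m0; apply: nmb; rewrite m0 tofrac0 !mul0r; exact: intg0.
have [x /Mb /intgP [y xb]|s [Ms sP]] := uniformizer_dual_basis maxM m0 Mm Mu _ N.
  exists y; apply/eqP; rewrite -tofrac_eq !tofracM -mb -xb.
  by rewrite -mulrA [b * _]mulrC.
by exists s.
Qed.

Lemma conductors_dual_basis N : @dual_basis D N 1.
Proof.
apply: contrapT => N1.
have [M maxM NM] := maximal_ideal_exists (dual_basis_ideal N) N1.
by have [s Ms /NM] := maximal_dual_basis N maxM.
Qed.

End Conductors.

End LocalDualBasis.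

(** * Krull domains and TV PVMDs *)

Section Krull.
Context (D : idomainType).
Local Notation K := {fraction D}.
Hypothesis krullD : krull_domain D.

(** This is complete integral closedness: stability would put [q b^n] in [D] for all [n], so
    [v(q) + n v(b) >= 0] for all [n], which forces [v(b) >= 0] for every [v] in [V]. *)
Lemma krull_unstable : conductors_unstable D.
Proof.
have [V [valV intV _]] := krullD.
move=> b nb; apply: contrapT => stab.
have [a [q [q0 qb]]] := frac_repr b.
have qb_int n : exists m : D, q%:F * b ^+ n = m%:F /\ intg (m%:F * b).
  elim: n => [|n [m [mE mb]]].
    by exists q; rewrite expr0 mulr1 qb; split=> //; exact: intg_frac.
  have /intgP [m' mbE] : intg (m%:F * b) by [].
  exists m'; rewrite exprSr mulrA mE mbE; split=> //; rewrite -mbE.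
  by apply: contrapT => nmb; apply: stab; exists m.
have b0 : b != 0 by apply: contra_notN nb => /eqP ->; exact: intg0.
have qF0 : q%:F != 0 by rewrite tofrac_eq0.
apply: nb; apply/(intV _ b0) => v Vv.
have [vM _ _] := valV _ Vv.
have vX n : v (q%:F * b ^+ n) = v q%:F + v b *+ n.
  elim: n => [|n IHn]; first by rewrite expr0 mulr1 mulr0n addr0.
  by rewrite exprSr mulrA vM ?mulf_neq0 ?expf_neq0 // IHn mulrSr addrA.
rewrite leNgt; apply/negP => vb.
pose n := `|v q%:F|%N.+1.
have [m [mE _]] := qb_int n.
have : 0 <= v (q%:F * b ^+ n).
  have qn0 : q%:F * b ^+ n != 0 by rewrite mulf_neq0 ?expf_neq0.
  by apply: (intV _ qn0).1 Vv; rewrite mE; exact: intg_frac.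
rewrite vX /n; move: (v q%:F) (v b) vb => x y y0.
have : y *+ `|x|.+1 <= (- 1) *+ `|x|.+1 by rewrite lerMn2r; lia.
rewrite mulNrn; lia.
Qed.

(** It suffices to test a nonzero [d] in [J] and, for each of the finitely many [v] with
    [v(d) != 0], an element of [J] of minimal value. Where [v(d) = 0], [d b] in [D] already gives
    [v(b) >= 0]. *)
Lemma krull_finitary : conductors_finitary D.
Proof.
have [V [valV intV finV]] := krullD.
move=> J idJ finJ.
(* If [J] is zero any [b] outside [D] works, and the empty list supplies one. *)
have [[d Jd d0]|J0] := pselect (exists2 d, J d & d != 0); last first.
  have [//|b nb _] := finJ [::]; exists b => // x Jx.
  have -> : x = 0 by apply/eqP/negP => /negP x0; apply: J0; exists x.
  by rewrite tofrac0 mul0r; exact: intg0.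
have dF0 : d%:F != 0 by rewrite tofrac_eq0.
have /finite_seqP [vs vsE] := finV _ dF0.
have /choice [x xP] : forall v : K -> int, exists x : D, [/\ J x, x != 0
    & V v -> forall y, J y -> y != 0 -> v x%:F <= v y%:F].
  move=> v; have [Vv|nV] := pselect (V v); last by exists d; split.
  have v_ge0 (y : D) : y != 0 -> 0 <= v y%:F.
    move=> y0; have yF0 : y%:F != 0 by rewrite tofrac_eq0.
    by have [/(_ (intg_frac y)) + _] := intV _ yF0; exact.
  have exn : exists n : nat, `[< exists2 y, J y & y != 0 /\ v y%:F = n%:Z >].
    exists `|v d%:F|%N; apply/asboolP; exists d => //; split=> //.
    by rewrite gez0_abs // v_ge0.
  have [n /asboolP [y Jy [y0 vy]] minn] := ex_minnP exn.
  exists y; split=> // _ z Jz z0; rewrite vy -(gez0_abs (v_ge0 _ z0)) lez_nat.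
  by apply: minn; apply/asboolP; exists z => //; rewrite gez0_abs ?v_ge0.
have [y|b nb bP] := finJ (d :: [seq x v | v <- vs]).
  by rewrite inE => /predU1P[->|/mapP[v _ ->]] //; have [] := xP v.
exists b => // y Jy; have [->|y0] := eqVneq y 0.
  by rewrite tofrac0 mul0r; exact: intg0.
have b0 : b != 0 by apply: contra_notN nb => /eqP ->; exact: intg0.
have neF (z : D) : z != 0 -> z%:F != 0 by rewrite tofrac_eq0.
apply/intV => [|v Vv]; first by rewrite mulf_neq0 ?neF.
have [vM _ _] := valV _ Vv; rewrite vM ?neF //.
have v_bz (z : D) : z != 0 -> intg (z%:F * b) -> 0 <= v z%:F + v b.
  move=> z0 zb; rewrite -vM ?neF //.
  by have [/(_ zb) + _] := intV _ (mulf_neq0 (neF z z0) b0); exact.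
have [vd0|vd0] := eqVneq (v d%:F) 0.
  have := v_bz d d0 (bP d (mem_head _ _)); rewrite vd0 add0r => vb.
  apply: addr_ge0 => //.
  by have [/(_ (intg_frac y)) + _] := intV _ (neF y y0); exact.
have vvs : v \in vs.
  by have : [set` vs]%classic v by rewrite -vsE.
have [Jx x0 minx] := xP v.
have vxb := v_bz _ x0 (bP (x v) _).
apply: le_trans (lerD (minx Vv _ Jy y0) (lexx (v b))); apply: vxb.
by rewrite inE map_f ?orbT.
Qed.

End Krull.

Section TVPVMD.
Context (D : idomainType).
Local Notation K := {fraction D}.
Local Open Scope classical_set_scope.

Lemma dspan_nth (s : seq K) i : (i < size s)%N -> dspan s s`_i.
Proof.
move=> si; exists (fun j => (j == i)%:R).
rewrite (bigD1 (Ordinal si)) //= eqxx tofrac1 mul1r big1 ?addr0 // => j ji.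
by rewrite -val_eqE /= in ji; rewrite (negbTE ji) tofrac0 mul0r.
Qed.

Lemma finv_dspan (s : seq K) (b : K) :
  (forall x, x \in s -> intg (b * x)) -> Defs.finv (dspan s) b.
Proof.
move=> sb _ [c ->]; rewrite mulr_sumr; apply: intg_sum => i _.
by rewrite mulrCA; apply: intgM; [exact: intg_frac | apply/sb/mem_nth].
Qed.

(** If no [b] works, the inverse of [I] lies in [D], so 1 is in [I_v = I_t] and thus in
    [vclosure (dspan s)] for a finite [s]. The [b] attached to [s] would then be in [D]. *)
Lemma tv_finitary : TV_domain D -> conductors_finitary D.
Proof.
move=> tvD J idJ finJ.
have [[d Jd d0]|J0] := pselect (exists2 d, J d & d != 0); last first.
  have [//|b nb _] := finJ [::]; exists b => // x Jx.
  have -> : x = 0 by apply/eqP/negP => /negP x0; apply: J0; exists x.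
  by rewrite tofrac0 mul0r; exact: intg0.
pose I : set K := (@tofrac D) @` J.
have idI : dideal I.
  split.
  - by move=> _ [x _ <-]; exact: intg_frac.
  - by exists 0; [exact: ideal0 | rewrite tofrac0].
  - move=> _ _ [x Jx <-] [y Jy <-]; exists (x + y); last exact: tofracD.
    exact: idealD.
  - move=> a _ [x Jx <-]; exists (a * x); last exact: tofracM.
    exact: idealM.
have I0 : nonzero I by exists d%:F; [exists d | rewrite tofrac_eq0].
apply: contrapT => nob.
have : vclosure I 1.
  move=> y Iy; rewrite mul1r; apply: contrapT => ny; apply: nob; exists y => // x Jx.
  by rewrite mulrC; apply: Iy; exists x.
rewrite -(tvD _ idI I0) => -[s [sI _ s1]].
have /choice [g gP] : forall x : K, exists y : D, I x -> J y /\ y%:F = x.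
  by move=> x; have [[y Jy yx]|nI] := pselect (I x); [exists y | exists 0].
have gs x : x \in s -> J (g x) /\ (g x)%:F = x.
  by move=> /(nthP 0) [i si <-]; apply/gP/sI; exact: dspan_nth.
have [y|b nb bP] := finJ [seq g x | x <- s].
  by move=> /mapP [x /gs [Jx _] ->].
apply: nb; rewrite -[b]mul1r; apply: s1; apply: finv_dspan => x xs.
have [_ <-] := gs x xs; rewrite mulrC; apply: bP; exact: map_f.
Qed.

(** Let [b = a/q] and [I = (q, a)]. For [x] in the inverse of [I], [m = q x] and [m b = a x] are in
    [D], and stability adds [m b^2]. So [b] multiplies [I] times its inverse into [D]; as the
    t-closure of that product contains 1, [b] is in [D]. *)
Lemma pvmd_unstable : PVMD D -> conductors_unstable D.
Proof.
move=> pvD b nb; apply: contrapT => stab.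
have [a [q [q0 qb]]] := frac_repr b.
pose I := dspan [:: q%:F; a%:F].
have IE x : I x <-> exists c e : D, x = c%:F * q%:F + e%:F * a%:F.
  split=> [[c ->]|[c [e ->]]].
    by exists (c 0%N), (c 1%N); rewrite !big_ord_recl big_ord0 addr0.
  by exists (nth 0 [:: c; e]); rewrite !big_ord_recl big_ord0 addr0.
have Iq : I q%:F by apply/IE; exists 1, 0; rewrite tofrac1 tofrac0 mul1r mul0r addr0.
have Ia : I a%:F by apply/IE; exists 0, 1; rewrite tofrac1 tofrac0 mul1r mul0r add0r.
have idI : dideal I.
  split.
  - move=> x /IE [c [e ->]]; apply: intgD; apply: intgM; exact: intg_frac.
  - by apply/IE; exists 0, 0; rewrite tofrac0 !mul0r addr0.
  - move=> x y /IE [c [e ->]] /IE [c' [e' ->]]; apply/IE; exists (c + c'), (e + e').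
    by rewrite !tofracD !mulrDl addrACA.
  - move=> d x /IE [c [e ->]]; apply/IE; exists (d * c), (d * e).
    by rewrite !tofracM mulrDr !mulrA.
have I0 : nonzero I by exists q%:F => //; rewrite tofrac_eq0.
have := pvD I idI I0 (ex_intro _ _ erefl).
move=> /(congr1 (fun A : set K => A 1)) => tcl1.
have : intg (1 : K) by rewrite -tofrac1; exact: intg_frac.
rewrite -tcl1 => -[s [sI _ s1]]; apply: nb; rewrite -[b]mul1r; apply: s1.
move=> y /sI [l [lP ->]]; rewrite mulr_sumr big_seq; apply: intg_sum => p /lP [].
move=> /IE [c [e ->]] Ip; move: p.2 Ip => x Ix.
have /intgP [m xq] := Ix _ Iq; have xa := Ix _ Ia.
have mb : intg (m%:F * b) by rewrite -xq -mulrA qb.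
have mbb : intg (m%:F * b * b) by apply: contrapT => nmbb; apply: stab; exists m.
have -> : b * ((c%:F * q%:F + e%:F * a%:F) * x) =
    c%:F * (m%:F * b) + e%:F * (m%:F * b * b).
  by rewrite -xq -qb; ring.
by apply: intgD; apply: intgM => //; exact: intg_frac.
Qed.

End TVPVMD.

Theorem corollary5 (D : idomainType) :
  polynomially_composite D \/ krull_domain D \/ TV_PVMD D ->
  exists! b : biring D (Int D), biring_hom (poly_biring D) b (int_incl D).
Proof.
move=> compD.
have {}compD : polynomially_composite D.
  case: compD => [//|[krullD|[pvD tvD]]]; apply: dual_basis_composite => N.
    exact: conductors_dual_basis (krull_finitary krullD) (krull_unstable krullD) N.
  exact: conductors_dual_basis (tv_finitary tvD) (pvmd_unstable pvD) N.
have [b bP] := composite_biring_exists compD.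
exists b; split=> // c; exact: biring_hom_int_unique.
Qed.
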